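(* Let $(f_n)_{n=1}^\infty$ be a regular polynomial sequence (as defined in the context), and for $m\in\mathbb{N}$ let $F_m=f_m\circ\cdots\circ f_1$ and let $\rho_m$ be the leading coefficient of $F_m$. Let $J_{(f_n)}$ be the Julia set for $(f_n)_{n=1}^\infty$. Then the following hold: (a) For each $m\in\mathbb{N}$, the $\deg F_m$-th Chebyshev polynomial on $J_{(f_n)}$ is of the form $F_m(z)/\rho_m-\tau_m$ for some $\tau_m\in\mathbb{C}$. (b) If, in addition, each $f_n$ is a linear combination of monomials of even degree, then $F_m(z)/\rho_m$ is the $\deg F_m$-th Chebyshev polynomial on $J_{(f_n)}$ for all $m\in\mathbb{N}$.
   Context: $\mathbb{N}=\{1,2,3,\ldots\}$ and $\overline{\mathbb{C}}=\mathbb{C}\cup\{\infty\}$ is the Riemann sphere with the chordal metric. Polynomials have complex coefficients and are regarded as maps $\overline{\mathbb{C}}\to\overline{\mathbb{C}}$. Monomials of even degree include the constant monomial $z^0$. Regular polynomial sequence: let $f_n(z)=\sum_{j=0}^{d_n}a_{n,j}z^j$ with $d_n\geq 2$ and $a_{n,d_n}\neq 0$ for all $n\in\mathbb{N}$. The sequence $(f_n)_{n=1}^\infty$ is a regular polynomial sequence if: (i) there is a real number $A_1>0$ such that $|a_{n,d_n}|\geq A_1$ for all $n\in\mathbb{N}$; (ii) there is a real number $A_2\geq 0$ such that $|a_{n,j}|\leq A_2|a_{n,d_n}|$ for $j=0,1,\ldots,d_n-1$ and all $n\in\mathbb{N}$; (iii) there is a real number $A_3$ such that $\log|a_{n,d_n}|\leq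 A_3\cdot d_n$ for all $n\in\mathbb{N}$. Julia set: the Fatou set for $(f_n)_{n=1}^\infty$ is the set of points of $\overline{\mathbb{C}}$ at which (i.e. on some neighborhood of which) the family $(F_n)_{n=1}^\infty$ is normal in the sense of Montel, with respect to the chordal metric. The Julia set $J_{(f_n)}$ is the complement in $\overline{\mathbb{C}}$ of the Fatou set. For a regular polynomial sequence, $J_{(f_n)}$ is a compact subset of $\mathbb{C}$ of positive logarithmic capacity (in particular infinite). Chebyshev polynomial: let $K\subset\mathbb{C}$ be compact with at least $N$ points. For $n\in\mathbb{N}$ with $n\leq N$, the $n$-th Chebyshev polynomial on $K$ is the unique monic polynomial $P_n$ of degree $n$ with $\|P_n\|_K=\inf_{Q\in\mathcal{P}_{n-1}}\|z^n-Q(z)\|_K$, where $\|\cdot\|_K$ is the sup-norm on $K$ and $\mathcal{P}_{n-1}$ is the space of all complex polynomials of degree at most $n-1$. *)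

(* Defs.v *)
From HB Require Import structures.
From mathcomp Require Import all_boot all_order all_algebra.
From mathcomp Require Import all_classical all_reals all_analysis.
From mathcomp Require Import complex ring lra.

Set Implicit Arguments.
Unset Strict Implicit.
Unset Printing Implicit Defensive.

Import Order.TTheory GRing.Theory Num.Theory.
Import numFieldNormedType.Exports.
Import ComplexField.Normc.

Local Open Scope classical_set_scope.
Local Open Scope ring_scope.
Local Open Scope complex_scope.

(* The Riemann sphere; [None] is the point at infinity. The alias keeps it
   apart from [option R[i]], so that the chordal metric can be attached to it. *)
Definition sphere (R : realType) : Type := option R[i].

HB.instance Definition _ (R : realType) :=
  Pointed.copy (sphere R) (option R[i]).

(* [normc] is the R-valued modulus; the norm [`|z|] of MathComp lives in R[i]. *)
Definition chordal_weight (R : realType) (z : R[i]) : R :=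
  Num.sqrt (1 + normc z ^+ 2).

Definition chordal (R : realType) (x y : sphere R) : R :=
  match x, y with
  | Some z, Some w =>
      2 * normc (z - w) / (chordal_weight z * chordal_weight w)
  | Some z, None => 2 / chordal_weight z
  | None, Some w => 2 / chordal_weight w
  | None, None => 0
  end.

Section chordal_metric.
Variable R : realType.
Implicit Types (z w u : R[i]) (x y : sphere R).

Local Notation cw := (@chordal_weight R).

Lemma normc_ge0 z : 0 <= normc z.
Proof. by case: z => a b; exact: sqrtr_ge0. Qed.

Lemma normcB z w : normc (z - w) = normc (w - z).
Proof. by rewrite -(normcN (z - w)) opprB. Qed.

Lemma chordal_weight_sqr z : cw z ^+ 2 = 1 + normc z ^+ 2.
Proof. by rewrite /chordal_weight sqr_sqrtr// addr_ge0// sqr_ge0. Qed.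

Lemma chordal_weight_gt0 z : 0 < cw z.
Proof. by rewrite /chordal_weight sqrtr_gt0 ltr_pwDl// sqr_ge0. Qed.

Lemma normc_le_weight z : normc z <= cw z.
Proof.
rewrite -ler_sqr ?nnegrE ?normc_ge0 ?(ltW (chordal_weight_gt0 z))//.
by rewrite chordal_weight_sqr lerDr.
Qed.

Lemma chordal_weight_lip z w : cw z <= cw w + normc (z - w).
Proof.
have w0 := chordal_weight_gt0 w; have d0 := normc_ge0 (z - w).
rewrite -ler_sqr ?nnegrE ?(ltW (chordal_weight_gt0 z)) ?addr_ge0 ?(ltW w0)//.
rewrite sqrrD !chordal_weight_sqr.
have lez : normc z <= normc w + normc (z - w).
  by rewrite -[z in normc z](subrK w) addrC le_normcD.
have := normc_le_weight w; have := normc_ge0 z; have := normc_ge0 w.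
move=> nw0 nz0 nww; nra.
Qed.

Lemma normc_sqr_formula z : normc z ^+ 2 = complex.Re z ^+ 2 + complex.Im z ^+ 2.
Proof. by case: z => a b; rewrite /= sqr_sqrtr// addr_ge0// sqr_ge0. Qed.

Lemma normc_1D_conj u z : normc (1 + u^* * z) <= cw u * cw z.
Proof.
have u0 := ltW (chordal_weight_gt0 u); have z0 := ltW (chordal_weight_gt0 z).
rewrite -ler_sqr ?nnegrE ?normc_ge0 ?mulr_ge0// exprMn !chordal_weight_sqr.
rewrite !normc_sqr_formula; case: u {u0} => a b; case: z {z0} => c d /=.
have := sqr_ge0 (a - c); have := sqr_ge0 (b - d); nra.
Qed.

Lemma chordalxx x : chordal x x = 0.
Proof. by case: x => [z|]//=; rewrite subrr normc0 mulr0 mul0r. Qed.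

Lemma chordal_sym x y : chordal x y = chordal y x.
Proof.
by case: x y => [z|] [w|]//=; rewrite normcB (mulrC (chordal_weight w)).
Qed.

Lemma chordal_eq0 x y : chordal x y = 0 -> x = y.
Proof.
have cw0 z : cw z != 0 by rewrite gt_eqF ?chordal_weight_gt0.
case: x y => [z|] [w|]//= /eqP; rewrite !mulf_eq0 invr_eq0 ?mulf_eq0
  ?(negPf (cw0 _)) pnatr_eq0//= ?orbF//.
by move=> /eqP/eq0_normc/eqP; rewrite subr_eq0 => /eqP ->.
Qed.

Lemma chordal_triangle (y x z : sphere R) :
  chordal x z <= chordal x y + chordal y z.
Proof.
have p0 := chordal_weight_gt0.
have n0 v : cw v != 0 by rewrite gt_eqF ?p0.
have fin_infty u v : 2 / cw u <= 2 * normc (u - v) / (cw u * cw v) + 2 / cw v.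
  have -> : 2 * normc (u - v) / (cw u * cw v) + 2 / cw v =
            2 * (cw u + normc (u - v)) / (cw u * cw v).
    by field; rewrite !n0.
  rewrite ler_pdivrMr//; have -> : 2 * (cw u + normc (u - v)) / (cw u * cw v)
      * cw u = 2 * (cw u + normc (u - v)) / cw v by field; rewrite !n0.
  rewrite ler_pdivlMr// ler_pM2l//.
  by rewrite normcB chordal_weight_lip.
case: x y z => [x|] [y|] [z|] /=; rewrite ?addr0 ?add0r//.
- have -> : 2 * normc (x - y) / (cw x * cw y)
          + 2 * normc (y - z) / (cw y * cw z)
     = 2 * (normc (x - y) * cw z + normc (y - z) * cw x) / (cw x * cw y * cw z).
    by field; rewrite !n0.
  rewrite ler_pdivlMr ?mulr_gt0//.
  have -> : 2 * normc (x - z) / (cw x * cw z) * (cw x * cw y * cw z) =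
     2 * (normc (x - z) * cw y) by field; rewrite !n0.
  rewrite ler_pM2l// -(ler_pM2r (p0 y)) -mulrA -expr2.
  have -> : normc (x - z) * cw y ^+ 2 = normc ((x - z) * (1 + y^* * y)).
    rewrite normcM chordal_weight_sqr; congr (_ * _).
    case: y => a b; rewrite /= sqr_sqrtr ?addr_ge0 ?sqr_ge0//.
    have -> : a * b + - b * a = 0 :> R by ring.
    rewrite addr0 expr0n addr0 sqrtr_sqr ger0_norm; first by ring.
    have := sqr_ge0 a; have := sqr_ge0 b; nra.
  have -> : (x - z) * (1 + y^* * y) =
      (x - y) * (1 + y^* * z) + (y - z) * (1 + y^* * x) by ring.
  apply: le_trans (le_normcD _ _) _; rewrite !normcM mulrDl.
  rewrite -!mulrA lerD// ler_wpM2l ?normc_ge0//.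
    by rewrite (mulrC (cw z)) normc_1D_conj.
  by rewrite (mulrC (cw x)) normc_1D_conj.
- rewrite ler_pdivrMr ?mulr_gt0//.
  have -> : (2 / cw x + 2 / cw z) * (cw x * cw z) = 2 * (cw x + cw z).
    by field; rewrite !n0.
  rewrite ler_pM2l//; apply: le_trans (le_normcD _ _) _.
  by rewrite normcN lerD// normc_le_weight.
- by rewrite addrC normcB (mulrC (cw y)) fin_infty.
- by rewrite addr_ge0// divr_ge0// ltW.
Qed.

HB.instance Definition _ := isMetric.Build R (sphere R)
  chordalxx chordal_eq0 chordal_sym chordal_triangle.

End chordal_metric.

Section definitions.
Variable R : realType.
Local Notation C := R[i].

(* A polynomial as a self-map of the sphere. *)
Definition sphere_map (p : {poly C}) (x : sphere R) : sphere R :=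
  match x with
  | Some z => Some p.[z]
  | None => if (size p <= 1)%N then Some p`_0 else None
  end.

(* Sequences are indexed from 1: the values at 0 of [f] and [compose_seq f] are
   never used, apart from [compose_seq f 0 = 'X] starting the recursion. *)
Fixpoint compose_seq (f : nat -> {poly C}) (m : nat) : {poly C} :=
  if m is m'.+1 then f m \Po compose_seq f m' else 'X.

Definition regular_poly_seq (f : nat -> {poly C}) : Prop :=
  [/\ forall n, (0 < n)%N -> (2 <= (size (f n)).-1)%N,
      exists2 A1 : R, 0 < A1 &
        forall n, (0 < n)%N -> A1 <= normc (lead_coef (f n)),
      exists2 A2 : R, 0 <= A2 &
        forall n j, (0 < n)%N -> (j < (size (f n)).-1)%N ->
          normc (f n)`_j <= A2 * normc (lead_coef (f n))
    & exists A3 : R, forall n, (0 < n)%N ->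
        ln (normc (lead_coef (f n))) <= A3 * ((size (f n)).-1)%:R].

(* Normality in the sense of Montel of the family [(G n)_(n >= 1)] on [U]:
   every sequence in the family has a subsequence converging uniformly on the
   compact subsets of [U]. *)
Definition normal_on (G : nat -> sphere R -> sphere R) (U : set (sphere R)) :=
  forall s : nat -> nat, (forall k, (0 < s k)%N) ->
  exists phi : nat -> nat, {homo phi : i j / (i < j)%N} /\
  exists g : sphere R -> sphere R,
    {family [set K | compact K /\ K `<=` U], G \o s \o phi @ \oo --> g}.

Definition fatou (f : nat -> {poly C}) : set (sphere R) :=
  [set x | exists U : set (sphere R), [/\ open U, U x &
     normal_on (fun n => sphere_map (compose_seq f n)) U]].

Definition julia (f : nat -> {poly C}) : set (sphere R) := ~` fatou f.

Definition supnorm (K : set C) (p : {poly C}) : R :=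
  sup [set normc p.[z] | z in K].

Definition minimal_monic (K : set C) (n : nat) (P : {poly C}) : Prop :=
  [/\ P \is monic, size P = n.+1 &
      supnorm K P =
        inf [set supnorm K ('X^n - Q) | Q in [set Q : {poly C} | (size Q <= n)%N]]].

(* [P] is the [n]-th Chebyshev polynomial on [K]; the conditions on [K] are
   those under which that polynomial is defined. *)
Definition is_chebyshev (K : set C) (n : nat) (P : {poly C}) : Prop :=
  [/\ compact (K : set C^o), (`I_n #<= K)%card & unique (minimal_monic K n) P].

End definitions.

(* Main.v *)
Require Import Defs.
From mathcomp Require Import all_boot all_order all_algebra.
From mathcomp Require Import all_classical all_reals all_analysis.
From mathcomp Require Import complex ring lra zify.

Set Implicit Arguments.
Unset Strict Implicit.
Unset Printing Implicit Defensive.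

Import Order.TTheory GRing.Theory Num.Theory.
Import numFieldNormedType.Exports.
Import ComplexField.Normc.

Local Open Scope classical_set_scope.
Local Open Scope ring_scope.
Local Open Scope complex_scope.

(** On the complement of the filled set [E = {z : F_n z bounded}] the iterates
    tend to infinity, and in the interior of [E] they are uniformly bounded
    polynomials, hence a normal family; so the Julia set [J] is the boundary of
    [E].  It follows that [J] is the preimage under [F_m] of the Julia set [K]
    of the shifted sequence [f_(m+1), f_(m+2), ...].  By Newton's identities,
    summing a monic polynomial [Q] of degree [d = deg F_m] over the fibre of
    [F_m] above [w] yields [d w / rho_m] plus a constant, so the sup-norm of
    [Q] on [J] is at least that of some [(w - c') / rho_m] on [K].  If [c]
    minimises the sup-norm of [w - c] on [K], then [(F_m - c) / rho_m] is
    therefore the Chebyshev polynomial.  For even [f_n] the set [K] is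
    symmetric, and uniqueness of the Chebyshev polynomial forces [c = 0]. *)

(** * Sums of a polynomial over the roots of another *)

Section fiber_sums.
Variable F : fieldType.
Implicit Types (rs ss : seq F) (p q : {poly F}).

(** Partial fractions: q p' / p is a polynomial plus the sum of the q(z) / (X - z), so the remainder
    [S] carries the sum of the values as its top coefficient. The factor ['X] lets the index
    [size rs] make sense for the empty list too. *)
Lemma sum_roots_remainder rs q :
  let p := \prod_(z <- rs) ('X - z%:P) in
  exists U S, [/\ q * p^`() = U * p + S, (size S <= size rs)%N &
    ('X * S)`_(size rs) = \sum_(z <- rs) q.[z]].
Proof.
elim: rs => [|z rs [U [S [eqS sS cS]]]] /=.
  exists 0, 0; rewrite !big_nil derivC mulr0 mul0r addr0 size_poly0.
  by split=> //; rewrite mulr0 coef0.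
set p := \prod_(y <- rs) ('X - y%:P) in eqS.
have sp : size p = (size rs).+1 by rewrite /p size_prod_XsubC.
have lp : p`_(size rs) = 1.
  have /monicP := monic_prod_XsubC rs xpredT id.
  by rewrite lead_coefE -/p sp.
have /factor_theorem [V eqV] : root (q - q.[z]%:P) z.
  by rewrite /root !hornerE subrr.
rewrite !big_cons -/p.
exists (V + U), (q.[z] *: p + ('X - z%:P) * S); split.
- rewrite derivM derivXsubC mul1r mulrDr [q * (('X - _) * _)]mulrCA eqS.
  rewrite -[q in LHS](subrK q.[z]%:P) eqV -mul_polyC; ring.
- rewrite (leq_trans (size_polyD _ _))// geq_max; apply/andP; split.
    by rewrite (leq_trans (size_scale_leq _ _))// sp.
  by rewrite (leq_trans (size_polyMleq _ _))// size_XsubC.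
- rewrite coefXM /= coefD coefZ lp mulr1; congr (_ + _).
  rewrite mulrBl coefB cS coefCM.
  by rewrite [S`__]nth_default// mulr0 subr0.
Qed.

(* Newton: for [size q <= size rs] the symmetric function [\sum q.[z]] does not
   involve the constant coefficient of [\prod ('X - z)]. *)
Lemma sum_fiber_const rs ss (c : F) q :
  \prod_(z <- rs) ('X - z%:P) = \prod_(z <- ss) ('X - z%:P) + c%:P ->
  (0 < size rs)%N -> size ss = size rs -> (size q <= size rs)%N ->
  \sum_(z <- rs) q.[z] = \sum_(z <- ss) q.[z].
Proof.
have := sum_roots_remainder rs q; have := sum_roots_remainder ss q.
have := size_prod_XsubC ss id; have := monic_prod_XsubC ss xpredT id.
have := size_prod_XsubC rs id.
set p1 := \prod_(z <- rs) _; set p2 := \prod_(z <- ss) _ => sp1 m2 sp2.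
move=> [U2 [S2 [e2 s2 <-]]] [U1 [S1 [e1 s1 <-]]] ep rs0 ess sq.
rewrite ess in s2 sp2 *.
(* [p1] and [p2] have the same derivative, so the two division identities can be subtracted. *)
have eU : (U1 - U2) * p2 = S2 - S1 - c *: U1.
  apply: (addrI (U2 * p2 + S1 + c *: U1)).
  have : U1 * p1 + S1 = U2 * p2 + S2.
    by rewrite -e1 -e2 ep derivD derivC addr0.
  rewrite ep -mul_polyC => h; transitivity (U1 * (p2 + c%:P) + S1); first ring.
  by rewrite h; ring.
(* Degree count in q p1' = U1 p1 + S1 with n = [size rs]: the left side has degree at most 2n - 2,
   so [U1] has degree at most n - 2. *)
have sU : (size U1 <= (size rs).-1)%N.
  have [->|U0] := eqVneq U1 0; first by rewrite size_poly0.
  have p10 : p1 != 0 by rewrite -size_poly_gt0 sp1.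
  have : (size (U1 * p1)%R <= maxn (size (q * p1^`())%R) (size S1))%N.
    rewrite -[U1 * p1](addrK S1) -e1 -(size_polyN S1); exact: size_polyD.
  rewrite size_mul// sp1 addnS /=.
  have sd : (size p1^`() <= size rs)%N.
    by have := lt_size_deriv p10; rewrite sp1.
  have := size_polyMleq q p1^`().
  have aux (a b d e g n : nat) : (a <= n -> b <= n -> d <= n -> 0 < n ->
    e <= (b + d).-1 -> g + n <= maxn e a -> g <= n.-1)%N by lia.
  exact: aux.
(* The right side of [eU] has smaller degree than [p2], so the factor in front of [p2] vanishes. *)
have e0 : U1 - U2 = 0.
  apply/eqP; apply/negPn/negP => n0.
  have : (size ((U1 - U2) * p2)%R <= size rs)%N.
    have s12 : (size (S2 - S1)%R <= size rs)%N.
      by rewrite (leq_trans (size_polyD _ _))// geq_max size_polyN s2.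
    rewrite eU (leq_trans (size_polyD _ _))// geq_max size_polyN s12.
    rewrite (leq_trans (size_scale_leq _ _))// (leq_trans sU)//; exact: leq_pred.
  rewrite size_Mmonic// sp2 addnS /= -[X in (_ <= X)%N]add0n leq_add2r leqn0.
  by rewrite size_poly_eq0 (negPf n0).
have -> : S1 = S2 - c *: U1.
  by apply/eqP; rewrite -subr_eq0 -oppr_eq0 opprB addrAC -eU e0 mul0r.
rewrite mulrBr coefB -scalerAr coefZ [in X in _ - X]coefXM.
(* The only possible discrepancy is c times the coefficient of [U1] at index [size rs] minus one,
   which is zero by [sU]. *)
by case: eqP rs0 => [->//|_ _]; rewrite [U1`__]nth_default// mulr0 subr0.
Qed.

End fiber_sums.

(** * The real modulus, fibres of polynomials, Cauchy's estimate and open mapping *)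

Section modulus.
Variable R : realType.
Local Notation C := R[i].
Implicit Types (z w : C) (p q : {poly C}).

Lemma ler_normcD z w : normc (z + w) <= normc z + normc w.
Proof. exact: le_normcD. Qed.

Lemma ler_normcB z w : normc (z - w) <= normc z + normc w.
Proof. by rewrite (le_trans (ler_normcD _ _))// (normcN w). Qed.

Lemma ler_dist_normcD z w u : normc (z - w) <= normc (z - u) + normc (u - w).
Proof. by rewrite -[z - w](subrKA u); exact: ler_normcD. Qed.

Lemma normc_eq0 z : (normc z == 0) = (z == 0).
Proof.
by apply/eqP/eqP => [/eq0_normc//|->]; rewrite normc0.
Qed.

Lemma normc_gt0 z : (0 < normc z) = (z != 0).
Proof. by rewrite lt0r normc_eq0 normc_ge0 andbT. Qed.

Lemma normcX z n : normc (z ^+ n) = normc z ^+ n.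
Proof. by elim: n => [|n IH]; rewrite ?expr0 ?normc1// !exprS normcM IH. Qed.

Lemma normc_real (x : R) : normc x%:C = `|x|.
Proof. by rewrite /= expr0n addr0 sqrtr_sqr. Qed.

Lemma normc_nat n : normc (n%:R : C) = n%:R.
Proof. by rewrite -(rmorph_nat (real_complex R)) normc_real normr_nat. Qed.

Lemma ler_normc_sum (I : Type) (s : seq I) (G : I -> C) :
  normc (\sum_(i <- s) G i) <= \sum_(i <- s) normc (G i).
Proof.
elim: s => [|i s IH]; first by rewrite !big_nil normc0.
by rewrite !big_cons (le_trans (ler_normcD _ _))// lerD2l.
Qed.

Lemma normc_prod (I : Type) (s : seq I) (G : I -> C) :
  normc (\prod_(i <- s) G i) = \prod_(i <- s) normc (G i).
Proof.
elim: s => [|i s IH]; first by rewrite !big_nil normc1.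
by rewrite !big_cons normcM IH.
Qed.

Lemma normc_horner_le p r z : normc z <= r ->
  normc p.[z] <= \sum_(i < size p) normc p`_i * r ^+ i.
Proof.
move=> zr; rewrite horner_coef (le_trans (ler_normc_sum _ _))//.
apply: ler_sum => i _; rewrite normcM normcX ler_wpM2l ?normc_ge0//.
by rewrite lerXn2r ?nnegrE ?normc_ge0// (le_trans _ zr)// normc_ge0.
Qed.

Lemma horner_continuous p z (e : R) : 0 < e ->
  exists2 d : R, 0 < d & forall w, normc (w - z) < d -> normc (p.[w] - p.[z]) < e.
Proof.
move=> e0.
have /factor_theorem [q eqq] : root (p - p.[z]%:P) z by rewrite /root !hornerE subrr.
(* [B] bounds the difference quotient [q] on the disc of radius 1 about [z]; the summand 1 keeps it
   positive. *)
pose B := 1 + \sum_(i < size q) normc q`_i * (normc z + 1) ^+ i.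
have B0 : 0 < B.
  rewrite ltr_pwDl// sumr_ge0// => i _; rewrite mulr_ge0 ?normc_ge0//.
  by rewrite exprn_ge0// addr_ge0 ?normc_ge0.
exists (Num.min 1 (e / B)) => [|w]; first by rewrite lt_min ltr01 divr_gt0.
rewrite lt_min ltr_pdivlMr// => /andP[w1 wB].
have -> : p.[w] - p.[z] = q.[w] * (w - z).
  have : (p - p.[z]%:P).[w] = (q * ('X - z%:P)).[w] by rewrite eqq.
  by rewrite !hornerE.
rewrite normcM; apply: le_lt_trans wB; rewrite mulrC ler_wpM2l ?normc_ge0//.
apply: le_trans (normc_horner_le q (r := normc z + 1) _) _.
  by rewrite -[w](subrK z) addrC (le_trans (ler_normcD _ _))// lerD2l ltW.
by rewrite /B lerDr.
Qed.

(** Multiplicities are kept in the list, so that sums over it are symmetric functions of the roots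
    of [p - w%:P]. *)
Lemma fiber_ex p w : (1 < size p)%N -> exists rs : seq C,
  [/\ size rs = (size p).-1, p - w%:P = lead_coef p *: \prod_(z <- rs) ('X - z%:P) &
    forall z, (z \in rs) = (p.[z] == w)].
Proof.
move=> sp; have [rs e] := closed_field_poly_normal (p - w%:P).
have sz : size (p - w%:P) = size p.
  by rewrite size_polyDl// size_polyN size_polyC; case: (w != 0) => //=; apply: ltnW.
have lc : lead_coef (p - w%:P) = lead_coef p.
  rewrite lead_coefDl// size_polyN size_polyC; case: (w != 0) => //=; exact: ltnW.
have l0 : lead_coef p != 0 by rewrite lead_coef_eq0 -size_poly_gt0 ltnW.
exists rs; rewrite -lc; split=> [|//|z].
  by rewrite -sz e size_scale ?lc// size_prod_XsubC.
rewrite -subr_eq0 -root_prod_XsubC -(rootZ _ _ (a := lead_coef (p - w%:P))) ?lc//.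
by rewrite -{1}lc -e /root !hornerE.
Qed.

Lemma fiber_sum_const p q w w' (rs rs' : seq C) : (1 < size p)%N ->
  (size q < size p)%N -> size rs = (size p).-1 -> size rs' = (size p).-1 ->
  p - w%:P = lead_coef p *: \prod_(z <- rs) ('X - z%:P) ->
  p - w'%:P = lead_coef p *: \prod_(z <- rs') ('X - z%:P) ->
  \sum_(z <- rs) q.[z] = \sum_(z <- rs') q.[z].
Proof.
move=> sp sq s1 s2 e1 e2.
have l0 : lead_coef p != 0 by rewrite lead_coef_eq0 -size_poly_gt0 ltnW.
apply: (@sum_fiber_const _ _ _ ((lead_coef p)^-1 * (w' - w))).
- apply: (scalerI l0); rewrite scalerDr -e1 -e2.
  by rewrite -mul_polyC -polyCM mulVKf// polyCB subrKA.
- by rewrite s1 -subn1 subn_gt0.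
- by rewrite s1.
- by rewrite s1 -ltnS prednK// ltnW.
Qed.

(* Averaging over the [N]-th roots of [r ^+ N] instead of integrating. *)
Lemma cauchy_estimate p (r M : R) : 0 < r ->
  (forall z, normc z = r -> normc p.[z] <= M) ->
  forall j, normc p`_j * r ^+ j <= M.
Proof.
move=> r0 bM j.
have [N pN jN] : exists2 N, (size p <= N)%N & (j < N)%N.
  by exists (size p + j).+1; rewrite ?ltnS ?leq_addl// leqW// leq_addr.
have N0 : (0 < N)%N by apply: leq_ltn_trans jN.
have sX : size ('X^N : {poly C}) = N.+1 by rewrite size_polyXn.
have [|rs [srs ers rsP]] := @fiber_ex 'X^N ((r ^+ N)%:C).
  by rewrite sX ltnS N0.
have nrs z : z \in rs -> normc z = r.
  rewrite rsP hornerXn => /eqP /(congr1 (@normc R)).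
  rewrite normcX normc_real ger0_norm ?exprn_ge0 ?ltW// => /eqP.
  by rewrite eqrXn2 ?normc_ge0 ?ltW// => /eqP.
rewrite sX /= in srs.
(* At each root of z^N = r^N this takes the value p(z) z^(N - j), while q(0) = r^N p_j. The fibre of
   ['X^N] above 0 is 0 repeated N times, so comparing the two fibre sums isolates p_j. *)
pose q := take_poly j p * 'X^(N - j) + (r ^+ N)%:C *: drop_poly j p.
have sq : (size q < size ('X^N : {poly C}))%N.
  rewrite sX ltnS (leq_trans (size_polyD _ _))// geq_max; apply/andP; split.
    rewrite (leq_trans (size_polyMleq _ _))// size_polyXn addnS /=.
    have aux (a n : nat) : (a <= j -> j <= n -> a + (n - j) <= n)%N by lia.
    by apply: aux; rewrite ?size_take_poly// ltnW.
  rewrite (leq_trans (size_scale_leq _ _))// size_drop_poly.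
  by rewrite (leq_trans (leq_subr _ _)).
have := fiber_sum_const (w' := 0) (rs' := nseq N 0) _ sq _ _ ers.
rewrite sX size_nseq subr0 lead_coefXn scale1r ; rewrite ltnS N0// => /(_ isT srs erefl).
have -> : \prod_(z <- nseq N (0 : C)) ('X - z%:P) = 'X^N.
  by rewrite big_nseq iter_mulr_1 polyC0 subr0.
move=> /(_ erefl); rewrite big_nseq.
have -> : iter N (+%R q.[0]) 0 = N%:R * ((r ^+ N)%:C * p`_j).
  rewrite iter_addr_0 mulr_natl; congr (_ *+ _).
  rewrite !hornerE expr0n subn_eq0 leqNgt jN mulr0 add0r horner_coef0.
  by rewrite coef_drop_poly.
move=> /(congr1 (@normc R)); rewrite !normcM normc_nat normc_real.
rewrite ger0_norm ?exprn_ge0 ?(ltW r0)// => eN.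
have : N%:R * (r ^+ N * normc p`_j) <= N%:R * (M * r ^+ (N - j)).
  rewrite -eN (le_trans (ler_normc_sum _ _))//.
  have -> : N%:R * (M * r ^+ (N - j)) = \sum_(z <- rs) (M * r ^+ (N - j)).
    by rewrite big_const_seq count_predT srs iter_addr_0 mulr_natl.
  rewrite big_seq [leRHS]big_seq; apply: ler_sum => z zrs.
  have nz := nrs z zrs.
  have -> : q.[z] = p.[z] * z ^+ (N - j).
    have zN : z ^+ N = (r ^+ N)%:C by move: zrs; rewrite rsP hornerXn => /eqP.
    rewrite -[p in RHS](poly_take_drop j) !hornerE -zN.
    have -> : z ^+ N = z ^+ j * z ^+ (N - j).
      by rewrite -exprD subnKC// ltnW.
    by ring.
  by rewrite normcM normcX nz; apply: ler_wpM2r; [rewrite exprn_ge0// ltW|exact: bM].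
rewrite ler_pM2l ?ltr0n ?N0// => h.
rewrite -(ler_pM2r (exprn_gt0 (N - j) r0)) (le_trans _ h)//.
by rewrite -mulrA -exprD subnKC ?(ltnW jN)// mulrC.
Qed.

(** If every root of p - w were at distance at least e from [z0], the factorisation would give
    |p(z0) - w| >= |lead_coef p| e^(deg p). *)
Lemma horner_open p z0 (e : R) : (1 < size p)%N -> 0 < e ->
  exists2 d : R, 0 < d & forall w, normc (w - p.[z0]) < d ->
    exists2 z, normc (z - z0) < e & p.[z] = w.
Proof.
move=> sp e0.
have l0 : lead_coef p != 0 by rewrite lead_coef_eq0 -size_poly_gt0 ltnW.
exists (normc (lead_coef p) * e ^+ (size p).-1) => [|w hw].
  by rewrite mulr_gt0 ?normc_gt0 ?exprn_gt0.
have [rs [srs ers rsP]] := fiber_ex w sp.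
have [/hasP[z zrs ze]|/hasPn far] := boolP (has (fun z => normc (z - z0) < e) rs).
  by exists z => //; move: zrs; rewrite rsP => /eqP.
exfalso; move: hw; apply/negP; rewrite -leNgt normcB.
have -> : p.[z0] - w = lead_coef p * \prod_(z <- rs) (z0 - z).
  have : (p - w%:P).[z0] = (lead_coef p *: \prod_(z <- rs) ('X - z%:P)).[z0] by rewrite ers.
  by rewrite !hornerE horner_prod; under eq_bigr do rewrite !hornerE.
rewrite normcM ler_wpM2l ?normc_ge0// normc_prod -srs.
have -> : e ^+ size rs = \prod_(z <- rs) e by rewrite big_const_seq count_predT iter_mulr_1.
rewrite big_seq [leRHS]big_seq; apply: ler_prod => z zrs.
by rewrite ltW//= normcB leNgt far.
Qed.

End modulus.

(** * Compactness and extrema in the complex plane *)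

Section plane_topology.
Variable R : realType.
Local Notation C := R[i].
Implicit Types (z w : C) (K : set C) (h : C -> R).

(** The norm of [C^o] takes values in [C], but a positive element of [C] is real, so the balls are
    discs of real radius. *)
Lemma nbhs_normc (z : C^o) (A : set C^o) : nbhs z A <->
  exists2 e : R, 0 < e & forall w, normc (w - z) < e -> A w.
Proof.
rewrite nbhs_ballP; split=> [[/= e e0 eA]|[e e0 eA]].
  move: e e0 eA => [a b]; rewrite ltcE /= => /andP[/eqP -> a0] eA.
  exists a => // w wz; apply: eA; rewrite -ball_normE /=.
  have : (normc (z - w))%:C < a%:C by rewrite ltcR normcB.
  exact.
exists e%:C => /=; first by rewrite ltcR.
move=> w; rewrite -ball_normE /= => zw; apply: eA.
have {}zw : (normc (z - w))%:C < e%:C := zw.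
by rewrite normcB -ltcR.
Qed.

Definition closed_bounded K : Prop := (exists M : R, forall z, K z -> normc z <= M) /\
  forall z, (forall e : R, 0 < e -> exists2 w, normc (w - z) < e & K w) -> K z.

Lemma normc_Re_Im (a b : R) : normc (a +i* b) <= `|a| + `|b|.
Proof.
have -> : a +i* b = a%:C + (0 +i* b).
  by apply/eqP; rewrite eq_complex /= addr0 add0r !eqxx.
rewrite (le_trans (ler_normcD _ _))// normc_real lerD2l.
by rewrite /= expr0n add0r sqrtr_sqr.
Qed.

Lemma ler_Re_normc z : `|complex.Re z| <= normc z.
Proof.
case: z => a b /=; rewrite -sqrtr_sqr ler_wsqrtr// lerDl; exact: sqr_ge0.
Qed.

Lemma ler_Im_normc z : `|complex.Im z| <= normc z.
Proof.
case: z => a b /=; rewrite -sqrtr_sqr ler_wsqrtr// lerDr; exact: sqr_ge0.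
Qed.

(** Heine-Borel: [K] is a closed part of the image of the compact square [-M, M]^2 under (a, b) -> a
    + ib. *)
Lemma closed_bounded_compact K : closed_bounded K -> compact (K : set C^o).
Proof.
move=> [[M bM] clK].
pose g (x : R * R) : C^o := x.1 +i* x.2.
have cg : continuous g.
  move=> [a b] A /nbhs_normc [e e0 eA].
  apply/nbhs_ballP; exists (e / 2) => /=; first by rewrite divr_gt0.
  move=> [a' b'] [/= ha hb]; apply: eA.
  have -> : g (a', b') - g (a, b) = (a' - a) +i* (b' - b).
    by apply/eqP; rewrite eq_complex /= !eqxx.
  rewrite (le_lt_trans (normc_Re_Im _ _))// [e]splitr ltrD// distrC.
    by move: ha; rewrite -ball_normE.
  by move: hb; rewrite -ball_normE.
have cI := @segment_compact R (- M) M.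
apply: (@subclosed_compact (C^o : topologicalType) K (g @` ([set` `[- M, M]] `*` [set` `[- M, M]]))).
- move=> z clz; apply: clK => e e0.
  have [] := clz [set w | normc (w - z) < e].
    by apply/nbhs_normc; exists e.
  by move=> w [Kw wz]; exists w.
- apply: continuous_compact; last exact: compact_setX.
  exact: continuous_subspaceT.
- move=> z Kz; exists (complex.Re z, complex.Im z); last by case: z {Kz}.
  have nz := bM z Kz; split => /=; rewrite in_itv /= -ler_norml.
    exact: le_trans (ler_Re_normc z) nz.
  exact: le_trans (ler_Im_normc z) nz.
Qed.

Lemma closed_bounded_disc z (r : R) : closed_bounded [set w | normc (w - z) <= r].
Proof.
split.
  exists (normc z + r) => w /= wz; rewrite -[w](subrK z) addrC.
  by rewrite (le_trans (ler_normcD _ _))// lerD2l.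
move=> w hw /=; apply/ler_addgt0Pr => e e0; have [v vw /= vz] := hw e e0.
by rewrite (le_trans (ler_dist_normcD _ _ v))// addrC lerD// normcB ltW.
Qed.

Definition continuous_normc h := forall z (e : R), 0 < e ->
  exists2 d : R, 0 < d & forall w, normc (w - z) < d -> `|h w - h z| < e.

Lemma closed_bounded_max K h : closed_bounded K -> K !=set0 -> continuous_normc h ->
  exists2 z, K z & forall w, K w -> h w <= h z.
Proof.
move=> /closed_bounded_compact cK K0 ch.
have [] := @compact_EVT_max (C^o : topologicalType) R h K K0 cK.
  apply: continuous_subspaceT => z A /nbhs_ballP [/= e e0 eA].
  have [d d0 dh] := ch z e e0; apply/nbhs_normc; exists d => // w wz.
  by apply: eA; rewrite -ball_normE /= distrC; apply: dh.
by move=> z /set_mem Kz mz; exists z => // w Kw; apply: mz; apply/mem_set.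
Qed.

Lemma continuous_normcN h : continuous_normc h -> continuous_normc (fun z => - h z).
Proof.
move=> ch z e e0; have [d d0 dh] := ch z e e0; exists d => // w wz.
by rewrite -opprD normrN; apply: dh.
Qed.

Lemma closed_bounded_min K h : closed_bounded K -> K !=set0 -> continuous_normc h ->
  exists2 z, K z & forall w, K w -> h z <= h w.
Proof.
move=> cK K0 ch; have [z Kz mz] := closed_bounded_max cK K0 (continuous_normcN ch).
by exists z => // w Kw; rewrite -lerN2; apply: mz.
Qed.

Lemma ler_dist_normc z w : `|normc z - normc w| <= normc (z - w).
Proof.
have h (u v : C) : normc u - normc v <= normc (u - v).
  by rewrite lerBlDr; have := ler_normcD (u - v) v; rewrite subrK.
by rewrite ler_norml lerNl opprB normcB h normcB h.
Qed.

Lemma continuous_normc_horner (p : {poly C}) : continuous_normc (fun z => normc p.[z]).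
Proof.
move=> z e e0; have [d d0 dp] := horner_continuous p z e0.
by exists d => // w wz; rewrite (le_lt_trans (ler_dist_normc _ _))// dp.
Qed.

End plane_topology.

(** * Chebyshev polynomials: characterisation, uniqueness and preimages *)

Section chebyshev.
Variable R : realType.
Local Notation C := R[i].
Implicit Types (z w : C) (K : set C) (p q P Q : {poly C}).

(** Equivalent to [K] being infinite. This form is what the uniqueness argument consumes and what
    the resultant argument on the filled set delivers. *)
Definition zariski_dense K : Prop :=
  forall q, q != 0 -> exists2 z, K z & q.[z] != 0.

Lemma zariski_dense_nonempty K : zariski_dense K -> K !=set0.
Proof. by move=> /(_ 1 (oner_neq0 _)) [z Kz _]; exists z. Qed.

Lemma zariski_dense_card K n : zariski_dense K -> (`I_n #<= K)%card.
Proof.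
move=> dK; have infK : infinite_set K.
  move=> /finite_seqP [s Ks].
  have [] := dK (\prod_(z <- s) ('X - z%:P)).
    by rewrite monic_neq0// monic_prod_XsubC.
  by move=> z; rewrite Ks /= -rootE root_prod_XsubC => ->.
apply: card_le_trans (proj1 (infiniteP K) infK).
exact: subset_card_le.
Qed.

Lemma supnorm_max K p : closed_bounded K -> K !=set0 ->
  exists2 z, K z & supnorm K p = normc p.[z].
Proof.
move=> cK K0; have [z Kz mz] := closed_bounded_max cK K0 (continuous_normc_horner p).
exists z => //; apply/eqP; rewrite eq_le; apply/andP; split.
  apply: ge_sup; first by exists (normc p.[z]), z.
  by move=> _ [w Kw <-]; exact: mz.
apply: ub_le_sup; last by exists z.
by exists (normc p.[z]) => _ [w Kw <-]; exact: mz.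
Qed.

Lemma supnorm_ub K p z : closed_bounded K -> K z -> normc p.[z] <= supnorm K p.
Proof.
move=> cK Kz.
have [y _ my] := closed_bounded_max cK (ex_intro _ z Kz) (continuous_normc_horner p).
apply: ub_le_sup; last by exists z.
by exists (normc p.[y]) => _ [w Kw <-]; exact: my.
Qed.

Lemma supnorm_ge0 K p : closed_bounded K -> K !=set0 -> 0 <= supnorm K p.
Proof. by move=> cK K0; have [z _ ->] := supnorm_max p cK K0; exact: normc_ge0. Qed.

(** The polynomials ['X^n - Q] are exactly the monic ones of degree n, and their norms are bounded
    below by 0, so the infimum becomes a minimum over monic competitors. *)
Lemma minimal_monicP K n P : closed_bounded K -> K !=set0 ->
  P \is monic -> size P = n.+1 ->
  minimal_monic K n P <->
  (forall Q, Q \is monic -> size Q = n.+1 -> supnorm K P <= supnorm K Q).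
Proof.
move=> cK K0 mP sP.
have sub Q : Q \is monic -> size Q = n.+1 -> (size ('X^n - Q)%R <= n)%N.
  move=> /monicP mQ sQ; apply/leq_sizeP => j; rewrite leq_eqVlt => /orP[/eqP <-|nj].
    by rewrite coefB coefXn eqxx -mQ lead_coefE sQ subrr.
  by rewrite coefB coefXn gtn_eqF// nth_default ?subrr// sQ.
have hlb : has_lbound [set supnorm K ('X^n - Q) | Q in [set Q : {poly C} | (size Q <= n)%N]].
  by exists 0 => _ [Q _ <-]; exact: supnorm_ge0.
have mem Q : Q \is monic -> size Q = n.+1 ->
    [set supnorm K ('X^n - Q) | Q in [set Q : {poly C} | (size Q <= n)%N]] (supnorm K Q).
  by move=> mQ sQ; exists ('X^n - Q); [exact: sub|rewrite opprB addrC subrK].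
split=> [[_ _ eP] Q mQ sQ|mP'].
  by rewrite eP; apply: ge_inf => //; exact: mem.
split=> //; apply/eqP; rewrite eq_le; apply/andP; split; last first.
  by apply: ge_inf => //; exact: mem.
apply: lb_le_inf; first by exists (supnorm K P); exact: mem.
move=> _ [Q /= sQ <-].
have sN : (size (- Q)%R < size ('X^n : {poly C}))%N by rewrite size_polyN size_polyXn.
apply: mP'; last by rewrite size_polyDl// size_polyXn.
by rewrite monicE lead_coefDl// lead_coefXn.
Qed.

Lemma normc_parallelogram z w :
  normc (z - w) ^+ 2 + normc (z + w) ^+ 2 = 2 * (normc z ^+ 2 + normc w ^+ 2).
Proof.
rewrite !normc_sqr_formula; case: z => a b; case: w => c d /=; ring.
Qed.

(** Strict convexity of the disc, from the parallelogram identity. *)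
Lemma normc_midpoint (M : R) z w : normc z <= M -> normc w <= M ->
  M <= normc ((z + w) / 2) -> z = w.
Proof.
move=> zM wM; rewrite normcM normcV normc_nat ler_pdivlMr// => zwM.
apply/eqP; rewrite -subr_eq0 -normc_eq0 -sqrf_eq0 eq_le sqr_ge0 andbT.
have := normc_parallelogram z w; have := normc_ge0 z; have := normc_ge0 w.
nra.
Qed.

(* If [G = P1 - P2] is non-zero, the mean [A] of [P1] and [P2] attains its norm
   only at roots of [G], where it agrees with [q = A mod G], which has degree
   [< n]; then [A - eps q] has a smaller norm for small [eps]. *)
Lemma minimal_monic_unique K n P1 P2 : closed_bounded K -> zariski_dense K ->
  minimal_monic K n P1 -> minimal_monic K n P2 -> P1 = P2.
Proof.
move=> cK dK mP1 mP2.
have [m1 s1 _] := mP1; have [m2 s2 _] := mP2.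
have K0 := zariski_dense_nonempty dK.
have min1 := (minimal_monicP cK K0 m1 s1).1 mP1.
have min2 := (minimal_monicP cK K0 m2 s2).1 mP2.
have [//|neq] := eqVneq P1 P2; exfalso.
pose M := supnorm K P1.
have eM : supnorm K P2 = M by apply/eqP; rewrite eq_le min2// min1.
have M0 : 0 < M.
  have [z Kz z0] := dK P1 (monic_neq0 m1).
  by rewrite (lt_le_trans _ (supnorm_ub P1 cK Kz))// normc_gt0.
pose G := P1 - P2; have G0 : G != 0 by rewrite subr_eq0.
have sG : (size G <= n)%N.
  apply/leq_sizeP => j; rewrite leq_eqVlt coefB => /orP[/eqP <-|nj].
    have := monicP m1; have := monicP m2; rewrite !lead_coefE s1 s2 /= => -> ->.
    by rewrite subrr.
  by rewrite !nth_default ?subrr ?s1 ?s2.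
pose A := 2^-1 *: (P1 + P2).
have two0 : (2 : C) != 0 by rewrite pnatr_eq0.
have A_P1 : A = P1 - 2^-1 *: G.
  by apply: (scalerI two0); rewrite scalerBr !scalerA divff// !scale1r scaler_nat mulr2n /G; ring.
have monicA q : (size q <= n)%N -> (P1 - q \is monic) /\ size (P1 - q) = n.+1.
  move=> sq; have lq : (size (- q)%R < size P1)%N by rewrite size_polyN s1.
  by rewrite monicE lead_coefDl// (monicP m1) size_polyDl.
pose q := A %% G.
have sq : (size q <= n)%N by rewrite (leq_trans _ sG)// ltnW// ltn_modp.
have Aub z : K z -> normc A.[z] <= M.
  move=> Kz; rewrite !hornerE normcM normcV normc_nat mulrC ler_pdivrMr//.
  rewrite mulr_natr mulr2n (le_trans (ler_normcD _ _))// lerD//.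
    exact: supnorm_ub.
  by rewrite -eM supnorm_ub.
have qA z : G.[z] = 0 -> q.[z] = A.[z].
  by move=> Gz; rewrite [in RHS](divp_eq A G) hornerD hornerM Gz mulr0 add0r.
have Alt z : K z -> M / 2 <= normc (A - q).[z] -> normc A.[z] < M.
  move=> Kz far; rewrite lt_neqAle Aub// andbT; apply/eqP => AM.
  have P12 : P1.[z] = P2.[z].
    apply: (@normc_midpoint M).
    - exact: supnorm_ub.
    - by rewrite -eM supnorm_ub.
    - by rewrite -AM !hornerE mulrC.
  have Gz : G.[z] = 0 by rewrite hornerD hornerN P12 subrr.
  by move: far; rewrite hornerD hornerN qA// subrr normc0 leNgt divr_gt0.
(* [K'] is compact and avoids the roots of [G], since [A - q] vanishes there; hence |A| stays below
   some M' < M on it. *)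
pose K' := K `&` [set z | M / 2 <= normc (A - q).[z]].
have cK' : closed_bounded K'.
  have [[B bB] clK] := cK; split; first by exists B => z [/bB].
  move=> z hz; split; first by apply: clK => e /hz [w wz [Kw _]]; exists w.
  rewrite /= leNgt; apply/negP => lt.
  have lt' : 0 < M / 2 - normc (A - q).[z] by rewrite subr_gt0.
  have [d d0 dh] := continuous_normc_horner (A - q) z lt'.
  have [w wz [_ /= fw]] := hz d d0.
  have := le_lt_trans (ler_norm _) (dh w wz); lra.
have [M' M'M M'ub] : exists2 M' : R, M' < M & forall z, K' z -> normc A.[z] <= M'.
  have [K'0|K'0] := pselect (K' !=set0); last first.
    by exists (M - 1) => [|z K'z]; [lra|case: K'0; exists z].
  have [z [Kz fz] mz] := closed_bounded_max cK' K'0 (continuous_normc_horner A).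
  by exists (normc A.[z]) => //; exact: Alt.
pose B := 1 + supnorm K q; have B0 : 0 < B by rewrite ltr_pwDl// supnorm_ge0.
have Bub z : K z -> normc q.[z] <= B.
  by move=> Kz; rewrite (le_trans (supnorm_ub q cK Kz))// /B lerDr.
(* Where |A - q| < M / 2, the convex combination T = (1 - eps) A + eps (A - q) has norm below M; on
   [K'] the second bound gives M' + eps B < M. *)
pose eps := Num.min (1 / 2) ((M - M') / (2 * B)).
have eps0 : 0 < eps by rewrite lt_min !divr_gt0 ?mulr_gt0// subr_gt0.
have eps1 : eps <= 1 / 2 by rewrite ge_min lexx.
have epsB : eps * B < M - M'.
  have : eps <= (M - M') / (2 * B) by rewrite ge_min lexx orbT.
  rewrite ler_pdivlMr ?mulr_gt0//; lra.
pose T := A - eps%:C *: q.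
have nT : normc (eps%:C) = eps by rewrite normc_real gtr0_norm.
have Tlt z : K z -> normc T.[z] < M.
  move=> Kz; have hT : T.[z] = A.[z] - eps%:C * q.[z] by rewrite hornerD hornerN [X in _ - X]hornerZ.
  have e1 : (1 - eps)%:C = 1 - eps%:C :> C by rewrite rmorphB rmorph1.
  have [near|far] := ltP (normc (A - q).[z]) (M / 2).
    have -> : T.[z] = (1 - eps)%:C * A.[z] + eps%:C * (A - q).[z].
      rewrite hT [(A - q).[z]]hornerD hornerN e1.
      by move: A.[z] q.[z] (real_complex _ _) => a b e; ring.
    rewrite (le_lt_trans (ler_normcD _ _))// !normcM nT normc_real.
    rewrite ger0_norm; last lra.
    have := Aub z Kz; have := normc_ge0 A.[z]; nra.
  rewrite hT (le_lt_trans (ler_normcB _ _))// normcM nT.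
  have := M'ub z (conj Kz far); have := Bub z Kz; nra.
have [z Kz Tz] := supnorm_max T cK K0.
(* [T] differs from [P1] only in degree below n, so it is a monic competitor. *)
have eT : T = P1 - (2^-1 *: G + eps%:C *: q) by rewrite /T A_P1; ring.
have [mT sT] : T \is monic /\ size T = n.+1.
  rewrite eT; apply: monicA; rewrite (leq_trans (size_polyD _ _))// geq_max.
  by rewrite !(leq_trans (size_scale_leq _ _)).
by have := min1 T mT sT; rewrite Tz leNgt Tlt.
Qed.

Lemma chebyshevP K n P : closed_bounded K -> zariski_dense K ->
  P \is monic -> size P = n.+1 ->
  (forall Q, Q \is monic -> size Q = n.+1 -> supnorm K P <= supnorm K Q) ->
  is_chebyshev K n P.
Proof.
move=> cK dK mP sP minP.
have mmP := (minimal_monicP cK (zariski_dense_nonempty dK) mP sP).2 minP.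
split; [exact: closed_bounded_compact|exact: zariski_dense_card|split=> // Q].
exact: minimal_monic_unique.
Qed.

(** The norm is 1-Lipschitz in the centre, and a centre farther than [Phi w0] from a point [w0] of
    [K] does worse than [w0] itself; so it suffices to minimise over a compact disc. *)
Lemma chebyshev_center K : closed_bounded K -> K !=set0 ->
  exists c, forall c', supnorm K ('X - c%:P) <= supnorm K ('X - c'%:P).
Proof.
move=> cK [w0 Kw0]; have K0 : K !=set0 by exists w0.
pose Phi c := supnorm K ('X - c%:P).
have lip c c' : Phi c <= Phi c' + normc (c' - c).
  rewrite /Phi; have [z Kz ->] := supnorm_max ('X - c%:P) cK K0.
  have := supnorm_ub ('X - c'%:P) cK Kz; rewrite !hornerE => h.
  by rewrite (le_trans (ler_dist_normcD _ _ c'))// lerD2r.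
have cPhi : continuous_normc Phi.
  move=> z e e0; exists e => // w wz; rewrite (le_lt_trans _ wz)//.
  by rewrite ler_norml lerNl opprB !lerBlDl lip normcB lip.
have cD := closed_bounded_disc w0 (Phi w0).
have [|c _ mc] := closed_bounded_min cD _ cPhi.
  by exists w0; rewrite /= subrr normc0 supnorm_ge0.
exists c => c'; have [h|h] := leP (normc (c' - w0)) (Phi w0); first exact: mc.
apply: (@le_trans _ _ (Phi w0)).
  by apply: mc; rewrite /= subrr normc0 supnorm_ge0.
rewrite (le_trans (ltW h))//; have := supnorm_ub ('X - c'%:P) cK Kw0.
by rewrite !hornerE normcB.
Qed.

(* The mean of a monic [Q] over the fibre of [p] above [w] is [w / rho] plus a
   constant, so [Q] cannot beat the best monic polynomial of degree one in [w]. *)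
Lemma chebyshev_preimage K p c : (1 < size p)%N ->
  closed_bounded K -> K !=set0 ->
  closed_bounded [set z | K p.[z]] -> zariski_dense [set z | K p.[z]] ->
  (forall c', supnorm K ('X - c%:P) <= supnorm K ('X - c'%:P)) ->
  is_chebyshev [set z | K p.[z]] (size p).-1
    ((lead_coef p)^-1 *: p - ((lead_coef p)^-1 * c)%:P).
Proof.
set rho := lead_coef p; set J := [set z | K p.[z]].
move=> sp cK K0 cJ dJ minc.
have rho0 : rho != 0 by rewrite lead_coef_eq0 -size_poly_gt0 ltnW.
have nrho : 0 < normc rho by rewrite normc_gt0.
have sP : size (rho^-1 *: p) = (size p).-1.+1.
  by rewrite size_scale ?invr_eq0// prednK// ltnW.
have sC (u : C) : (size (- u%:P) < size (rho^-1 *: p))%N.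
  rewrite sP prednK ?(ltnW sp)// size_polyN size_polyC.
  by case: (u != 0) => //=; exact: ltnW.
have mP : rho^-1 *: p \is monic by rewrite monicE lead_coefZ mulVf.
have J0 := zariski_dense_nonempty dJ.
apply: chebyshevP => //.
- by rewrite monicE lead_coefDl// (monicP mP).
- by rewrite size_polyDl.
move=> Q mQ sQ; set d := (size p).-1 in sP sQ.
have d0 : (0 < d)%N by rewrite /d -subn1 subn_gt0.
have dR : (0 : R) < d%:R by rewrite ltr0n.
have [w0 Kw0] := K0.
have [rs0 [srs0 ers0 rsP0]] := fiber_ex w0 sp.
pose r := Q - rho^-1 *: p.
have sr : (size r < size p)%N.
  have -> : size p = d.+1 by rewrite prednK// ltnW.
  rewrite ltnS; apply/leq_sizeP => j; rewrite leq_eqVlt coefB => /orP[/eqP <-|nj].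
    have := monicP mQ; have := monicP mP; rewrite !lead_coefE sP sQ /= => -> ->.
    by rewrite subrr.
  by rewrite !nth_default ?subrr ?sP ?sQ.
pose t := \sum_(z <- rs0) r.[z].
(* The mean of [Q] over the fibre above w is w / rho + t / d, and this [c'] rewrites it as (w - c')
   / rho. The sum [t] is the same for all fibres because [r] has smaller degree than [p]. *)
pose c' := - (rho * t / d%:R).
have mean w : K w -> normc (w - c') <= normc rho * supnorm J Q.
  move=> Kw; have [rs [srs ers rsP]] := fiber_ex w sp.
  have sumQ : \sum_(z <- rs) Q.[z] = d%:R * (rho^-1 * (w - c')).
    have -> : \sum_(z <- rs) Q.[z] = \sum_(z <- rs) (rho^-1 * w) + \sum_(z <- rs) r.[z].
      rewrite -big_split /= big_seq [RHS]big_seq; apply: eq_bigr => z.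
      by rewrite rsP => /eqP <-; rewrite /r hornerD hornerN hornerZ [RHS]addrC subrK.
    rewrite (fiber_sum_const sp sr srs srs0 ers ers0) -/t.
    rewrite big_const_seq count_predT srs iter_addr_0 -/d -mulr_natl /c'.
    by field; rewrite rho0 pnatr_eq0 -lt0n d0.
  have : normc (\sum_(z <- rs) Q.[z]) <= d%:R * supnorm J Q.
    rewrite (le_trans (ler_normc_sum _ _))//.
    have -> : d%:R * supnorm J Q = \sum_(z <- rs) supnorm J Q.
      by rewrite big_const_seq count_predT srs iter_addr_0 mulr_natl.
    rewrite big_seq [leRHS]big_seq; apply: ler_sum => z.
    by rewrite rsP => /eqP pz; apply: supnorm_ub => //; rewrite /J /= pz.
  rewrite sumQ !normcM normc_nat ler_pM2l// normcV.
  by rewrite mulrC ler_pdivrMr// mulrC.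
have [z Jz ->] := supnorm_max (rho^-1 *: p - (rho^-1 * c)%:P) cJ J0.
have -> : (rho^-1 *: p - (rho^-1 * c)%:P).[z] = rho^-1 * (p.[z] - c).
  by rewrite !hornerE mulrBr.
rewrite normcM normcV mulrC ler_pdivrMr// mulrC.
have := supnorm_ub ('X - c%:P) cK Jz; rewrite !hornerE => /le_trans; apply.
apply: le_trans (minc c') _.
have [w Kw ->] := supnorm_max ('X - c'%:P) cK K0.
by rewrite !hornerE mean.
Qed.

End chebyshev.

(** * The filled set of bounded orbits, its boundary, and their invariance and density *)

Section filled_set.
Variable R : realType.
Local Notation C := R[i].
Implicit Types (z w : C) (p q : {poly C}) (f : nat -> {poly C}) (r : R).

Lemma closed_bounded_cluster (K : set C) (u : nat -> C) : closed_bounded K ->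
  (forall n, K (u n)) -> exists2 z, K z &
  forall (e : R) N, 0 < e -> exists2 n, (N <= n)%N & normc (u n - z) < e.
Proof.
move=> /closed_bounded_compact cK Ku.
have [] := cK (u n @[n --> \oo]) _; first by exists 0%N => // n _; exact: Ku.
move=> z [Kz clz]; exists z => // e N e0.
have [] := clz [set w | exists2 n, (N <= n)%N & w = u n] [set w | normc (w - z) < e].
- by exists N => // n /= Nn; exists n.
- by apply/nbhs_normc; exists e.
- by move=> _ [[n Nn ->] /= h]; exists n.
Qed.

(** Sequences start at index 1, so the shifted one begins with [f m.+1]. *)
Definition shift_seq m f : nat -> {poly C} := fun n => f (n + m)%N.

Lemma compose_seqD f m n :
  compose_seq f (n + m) = compose_seq (shift_seq m f) n \Po compose_seq f m.
Proof.
elim: n => [|n IH]; first by rewrite comp_polyX.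
by rewrite addSn /= IH comp_polyA.
Qed.

Lemma horner_compose_seqD f m n z : (compose_seq f (n + m)).[z] =
  (compose_seq (shift_seq m f) n).[(compose_seq f m).[z]].
Proof. by rewrite compose_seqD horner_comp. Qed.

Lemma regular_shift m f : regular_poly_seq f -> regular_poly_seq (shift_seq m f).
Proof.
have pos n : (0 < n)%N -> (0 < n + m)%N by rewrite addn_gt0 => ->.
move=> [h1 [A1 A10 h2] [A2 A20 h3] [A3 h4]]; split.
- by move=> n n0; apply/h1/pos.
- by exists A1 => // n n0; apply/h2/pos.
- by exists A2 => // n j n0; apply/h3/pos.
- by exists A3 => n n0; apply/h4/pos.
Qed.

(** One radius serves all indices, hence all shifted sequences; beyond it orbits grow at least like
    powers of 2. *)
Definition escape_radius r f := 1 <= r /\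
  forall n, (0 < n)%N -> forall z, r < normc z -> 2 * normc z <= normc (f n).[z].

Lemma escape_shift r m f : escape_radius r f -> escape_radius r (shift_seq m f).
Proof. by move=> [r1 hr]; split=> // n n0; apply: hr; rewrite addn_gt0 n0. Qed.

(** Let x = |z| exceed the radius and a be the modulus of the leading coefficient. The lower terms
    sum to at most a A2 (x^d - 1) / (x - 1) <= a x^d / 2, because x - 1 >= 2 A2. So |f_n(z)| >= a
    x^d / 2 >= A1 x^2 / 2 >= 2x, as d >= 2 and A1 x >= 4. *)
Lemma regular_escape f : regular_poly_seq f -> exists r, escape_radius r f.
Proof.
move=> [h1 [A1 A10 h2] [A2 A20 h3] _]; exists (2 + 2 * A2 + 4 / A1).
have h0 : 0 < 4 / A1 by rewrite divr_gt0.
split=> [|n n0 z]; first by lra.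
move: (h1 n n0) (h2 n n0) (fun j => @h3 n j n0).
set d := (size (f n)).-1 => d2 lcA cA rz.
set x := normc z in rz *; set a := normc (lead_coef (f n)) in lcA cA *.
have x1 : 1 < x by lra.
have A1x : 4 <= A1 * x.
  have : A1 * (4 / A1) <= A1 * x by rewrite ler_wpM2l ?(ltW A10)//; lra.
  by rewrite mulrCA divff ?mulr1// gt_eqF.
have sf : size (f n) = d.+1 by move: d2; rewrite /d; case: (size (f n)).
have -> : (f n).[z] = lead_coef (f n) * z ^+ d + \sum_(i < d) (f n)`_i * z ^+ i.
  by rewrite horner_coef sf big_ord_recr /= addrC lead_coefE.
set s := \sum_(i < d) _.
have sle : normc s <= a * x ^+ d / 2.
  have : normc s <= \sum_(i < d) A2 * a * x ^+ i.
    rewrite (le_trans (ler_normc_sum _ _))//; apply: ler_sum => i _.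
    by rewrite normcM normcX ler_wpM2r ?exprn_ge0 ?normc_ge0// cA.
  rewrite -mulr_sumr => /le_trans; apply.
  have := subrX1 x d; set g := \sum_(i < d) x ^+ i => eg.
  have g0 : 0 <= g by apply: sumr_ge0 => i _; rewrite exprn_ge0// normc_ge0.
  have : 2 * (A2 * g) <= x ^+ d by nra.
  have : 0 <= a by exact: normc_ge0.
  nra.
have xd : x ^+ 2 <= x ^+ d by rewrite ler_weXn2l// ltW.
have : a * x ^+ d <= normc (lead_coef (f n) * z ^+ d + s) + normc s.
  rewrite -normcX -normcM; have := ler_normcB (lead_coef (f n) * z ^+ d + s) s.
  by rewrite addrK.
have : A1 * x ^+ 2 <= a * x ^+ d.
  by rewrite ler_pM// ?(ltW A10)// exprn_ge0// ltW// (lt_trans ltr01).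
move: A1x sle xd; rewrite expr2; nra.
Qed.

Lemma escape_iter r f n k z : escape_radius r f -> r < normc (compose_seq f n).[z] ->
  2 ^+ k * normc (compose_seq f n).[z] <= normc (compose_seq f (k + n)).[z].
Proof.
move=> [r1 hr] rz; elim: k => [|k IH]; first by rewrite mul1r.
have big : r < normc (compose_seq f (k + n)).[z].
  apply: lt_le_trans IH; apply: lt_le_trans rz _.
  by rewrite ler_peMl ?normc_ge0// exprn_ege1// ler1n.
rewrite addSn /= horner_comp exprS -mulrA.
by rewrite (le_trans _ (hr _ _ _ big))// ler_pM2l.
Qed.

Lemma escape_forward r f n m z : escape_radius r f -> (n <= m)%N ->
  r < normc (compose_seq f n).[z] -> r < normc (compose_seq f m).[z].
Proof.
move=> hr nm rz; have := escape_iter (m - n) hr rz; rewrite subnK// => /(lt_le_trans _); apply.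
apply: lt_le_trans rz _.
by rewrite ler_peMl ?normc_ge0// exprn_ege1// ler1n.
Qed.

(** For an escape radius [r] this is the set of points with bounded orbit, since a single value
    beyond [r] sends the orbit to infinity. *)
Definition filled r f : set C := [set z | forall n, normc (compose_seq f n).[z] <= r].

Definition filled_boundary r f : set C := [set z | filled r f z /\
  forall e : R, 0 < e -> exists2 w, normc (w - z) < e & ~ filled r f w].

(** An orbit that leaves the disc at time n is still outside at time m + n, so the condition on the
    iterates from time m on implies the one on the earlier iterates. *)
Lemma filled_shift r f m z : escape_radius r f ->
  filled r f z <-> filled r (shift_seq m f) (compose_seq f m).[z].
Proof.
move=> hr; split=> [fz n|fz n]; first by rewrite -horner_compose_seqD.
rewrite leNgt; apply/negP => rz.
have := escape_forward hr (leq_addr m n) rz.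
by rewrite horner_compose_seqD ltNge fz.
Qed.

(** Points outside the filled set are pushed forward by continuity of F_m and pulled back by its
    openness. *)
Lemma filled_boundary_shift r f m z : escape_radius r f ->
  (1 < size (compose_seq f m))%N ->
  filled_boundary r f z <-> filled_boundary r (shift_seq m f) (compose_seq f m).[z].
Proof.
move=> hr sF; split=> -[/(filled_shift m z hr) fz hz]; split=> // e e0.
  have [d d0 dF] := horner_continuous (compose_seq f m) z e0.
  have [w wz nw] := hz d d0; exists (compose_seq f m).[w]; first exact: dF.
  by move=> /(filled_shift m w hr).
have [d d0 dF] := horner_open z sF e0; have [w wz nw] := hz d d0.
have [y yz ey] := dF w wz; exists y => //; rewrite -ey in nw.
by move=> /(filled_shift m y hr).
Qed.

Lemma closed_bounded_filled r f : closed_bounded (filled r f).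
Proof.
split; first by exists r => z /(_ 0%N); rewrite /= hornerX.
move=> z hz n; apply/ler_addgt0Pr => e e0.
have [d d0 dF] := continuous_normc_horner (compose_seq f n) z e0.
have [w wz /(_ n) fw] := hz d d0.
have := dF w wz; rewrite distrC => /(le_lt_trans (ler_norm _)); lra.
Qed.

Lemma closed_bounded_filled_boundary r f : closed_bounded (filled_boundary r f).
Proof.
have [[M bM] clF] := closed_bounded_filled r f; split.
  by exists M => z [/bM].
move=> z hz; split; first by apply: clF => e /hz [w wz [fw _]]; exists w.
move=> e e0; have e20 : 0 < e / 2 by rewrite divr_gt0.
have [w wz [_ /(_ _ e20)[y yw ny]]] := hz _ e20.
by exists y => //; rewrite (le_lt_trans (ler_dist_normcD _ _ w))// [e]splitr ltrD.
Qed.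

Section regular.
Variables (f : nat -> {poly C}) (r : R).
Hypotheses (f_regular : regular_poly_seq f) (hr : escape_radius r f).
Local Notation F := (compose_seq f).

Lemma size_regular n : (0 < n)%N -> (2 < size (f n))%N.
Proof.
have [h _ _ _] := f_regular.
by move=> /h; case: (size (f n)) => //= -[].
Qed.

Lemma size_compose_seq n : (1 < size (F n))%N.
Proof.
elim: n => [|n IH]; first by rewrite size_polyX.
have := size_comp_poly (f n.+1) (F n); have := size_regular (ltn0Sn n).
move: IH => /=; case: (size (F n)) => // a; case: (size (f _)) => // b /=.
case: (size _) => [|s] /=; nia.
Qed.

(** With |a| <= B^d for the leading coefficient a of f_(n+1), the step rho -> a rho^d preserves the
    bound because B^(d + 2) <= B^(2d) for d >= 2; the extra factor B^2 is what closes the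
    induction. *)
Lemma lead_coef_compose_seq_bound : exists2 B : R, 1 <= B &
  forall n, normc (lead_coef (F n)) * B ^+ 2 <= (B ^+ 2) ^+ (size (F n)).-1.
Proof.
have [_ [A1 A10 h2] _ [A3 h4]] := f_regular.
exists (expR `|A3|) => [|n]; first by rewrite -expR0 ler_expR.
set B := expR _; have B1 : 1 <= B by rewrite -expR0 ler_expR.
have B0 : 0 < B by exact: lt_le_trans B1.
elim: n => [|n IH]; first by rewrite lead_coefX normc1 mul1r size_polyX.
have aB : normc (lead_coef (f n.+1)) <= B ^+ (size (f n.+1)).-1.
  have a0 : 0 < normc (lead_coef (f n.+1)) by rewrite (lt_le_trans A10)// h2.
  rewrite -[leLHS]lnK ?posrE// -expRM_natl ler_expR mulrC.
  by rewrite (le_trans (h4 _ _))// ler_wpM2r// ler_norm.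
rewrite /= lead_coef_comp ?size_compose_seq// normcM normcX size_comp_poly.
set d := (size (f n.+1)).-1 in aB *; set D := (size (F n)).-1 in IH *.
have d2 : (2 <= d)%N by rewrite /d; have := size_regular (ltn0Sn n); case: (size _).
set rho := normc (lead_coef (F n)) in IH *.
have rho0 : 0 <= rho by exact: normc_ge0.
rewrite mulnC exprM; apply: (@le_trans _ _ ((rho * B ^+ 2) ^+ d)); last first.
  by rewrite lerXn2r ?nnegrE ?exprn_ge0 ?mulr_ge0 ?exprn_ge0// ltW.
have -> : (rho * B ^+ 2) ^+ d = rho ^+ d * (B ^+ d * B ^+ d).
  by rewrite exprMn -exprM mulnC exprM [X in _ * X]expr2.
rewrite mulrAC mulrC ler_wpM2l ?exprn_ge0// ler_pM ?normc_ge0 ?exprn_ge0 ?(ltW B0)//.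
by rewrite ler_weXn2l.
Qed.

(* If [q] vanished on the filled set, then by compactness [|q| < delta] on
   [{|F n| <= r}] for large [n].  The product of [q] over the fibre of [F n]
   above [w] is, up to sign, the resultant [\prod_b (F n b - w) / rho], [b]
   ranging over the roots of [q]; Cauchy's estimate on [|w| = r] bounds it
   below, contradicting the bound on the leading coefficient [rho]. *)
Lemma zariski_dense_filled : zariski_dense (filled r f).
Proof.
move=> q0 q00; apply: contrapT => nq0.
have [r1 _] := hr.
have [bs ebs] := closed_field_poly_normal q0.
pose q := \prod_(b <- bs) ('X - b%:P); pose k := size bs.
have q_filled z : filled r f z -> q.[z] = 0.
  move=> fz; apply/eqP; apply: contrapT => /negP qz; case: nq0; exists z => //.
  by rewrite ebs hornerZ mulf_neq0// lead_coef_eq0.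
have [B B1 lB] := lead_coef_compose_seq_bound.
have B0 : 0 < B by exact: lt_le_trans B1.
(* Since |rho| <= B^(2D), this choice gives |rho|^k delta^D <= 2^(-D) < 1. *)
pose delta := (B ^+ 2) ^- k / 2.
have delta0 : 0 < delta by rewrite divr_gt0// invr_gt0 !exprn_gt0.
have [n small] : exists n, forall z, normc (F n).[z] <= r -> normc q.[z] < delta.
  apply: contrapT => nsmall.
  have /choice [u hu] : forall n, exists z, normc (F n).[z] <= r /\ delta <= normc q.[z].
    move=> n; apply: contrapT => nz; apply: nsmall; exists n => z Fz.
    by rewrite ltNge; apply/negP => qz; apply: nz; exists z.
  (* An orbit inside the disc at time n was inside at all earlier times. A cluster point of [u]
     therefore lies in the filled set, where [q] vanishes, against |q(u n)| >= delta. *)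
  have dec n m : (m <= n)%N -> normc (F m).[u n] <= r.
    move=> mn; rewrite leNgt; apply/negP => /(escape_forward hr mn).
    by rewrite ltNge (hu n).1.
  have [|z _ clz] := closed_bounded_cluster (closed_bounded_disc 0 r) (u := u).
    by move=> n; have := dec n 0%N isT; rewrite /= hornerX subr0.
  have fz : filled r f z.
    move=> m; apply/ler_addgt0Pr => e e0.
    have [d d0 dF] := continuous_normc_horner (F m) z e0.
    have [n mn /dF] := clz d m d0; rewrite distrC => /(le_lt_trans (ler_norm _)).
    have := dec n m mn; lra.
  have [d d0 dq] := continuous_normc_horner q z delta0.
  have [n _ /dq /(le_lt_trans (ler_norm _))] := clz d 0%N d0.
  have := (hu n).2; rewrite (q_filled z fz) normc0; lra.
have sF := size_compose_seq n.
set rho := lead_coef (F n); set D := (size (F n)).-1.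
have rho0 : 0 < normc rho by rewrite normc_gt0 lead_coef_eq0 -size_poly_gt0 ltnW.
have D0 : (0 < D)%N by rewrite /D -subn1 subn_gt0.
pose H := \prod_(b <- bs) ('X - ((F n).[b])%:P).
have boundH w : normc w = r -> normc H.[w] <= normc rho ^+ k * delta ^+ D.
  move=> wr; have [rs [srs ers rsP]] := fiber_ex w sF.
  have -> : normc H.[w] = normc rho ^+ k * \prod_(z <- rs) normc q.[z].
    have hb b : normc (w - (F n).[b]) = normc rho * \prod_(z <- rs) normc (z - b).
      rewrite normcB; have : (F n - w%:P).[b] = (rho *: \prod_(z <- rs) ('X - z%:P)).[b].
        by rewrite ers.
      rewrite hornerD hornerN hornerC => ->; rewrite hornerZ normcM horner_prod normc_prod.
      by congr (_ * _); apply: eq_bigr => z _; rewrite !hornerE normcB.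
    rewrite horner_prod normc_prod.
    under eq_bigr do rewrite hornerD hornerX hornerN hornerC hb.
    rewrite big_split /= big_const_seq count_predT iter_mulr_1; congr (_ * _).
    rewrite exchange_big /=; apply: eq_bigr => z _.
    rewrite horner_prod normc_prod; apply: eq_bigr => b _.
    by rewrite !hornerE.
  rewrite ler_wpM2l ?exprn_ge0 ?(ltW rho0)//.
  have -> : delta ^+ D = \prod_(z <- rs) delta.
    by rewrite big_const_seq count_predT iter_mulr_1 srs.
  rewrite big_seq [leRHS]big_seq; apply: ler_prod => z.
  by rewrite rsP normc_ge0 => /eqP Fz; rewrite ltW// small// Fz wr.
(* [H] is monic of degree k, so its top coefficient yields r^k <= |rho|^k delta^D, impossible for r
   >= 1. *)
have := cauchy_estimate (lt_le_trans ltr01 r1) boundH k.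
have -> : H`_k = 1.
  have /monicP := monic_prod_XsubC bs xpredT (fun b => (F n).[b]).
  by rewrite lead_coefE size_prod_XsubC.
rewrite normc1 mul1r; apply/negP; rewrite -ltNge.
have rhoB : normc rho <= (B ^+ 2) ^+ D.
  by rewrite (le_trans _ (lB n))// ler_peMr ?normc_ge0// exprn_ege1.
apply: (@lt_le_trans _ _ 1); last by rewrite exprn_ege1.
apply: (@le_lt_trans _ _ (((B ^+ 2) ^+ D) ^+ k * delta ^+ D)).
  rewrite ler_wpM2r ?exprn_ge0 ?(ltW delta0)// lerXn2r ?nnegrE ?normc_ge0//.
  by rewrite !exprn_ge0// ltW.
rewrite -exprM mulnC exprM -exprMn /delta mulrA divff ?mul1r; last first.
  by rewrite gt_eqF// !exprn_gt0.
by rewrite exprn_ilt1 ?invr_ge0 ?invf_lt1 ?ltr1n// -lt0n.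
Qed.

(** Maximum principle: |q X| attains its maximum over the filled set at a point z with q(z) nonzero,
    and by open mapping z cannot be interior. The factor ['X] makes the polynomial non-constant even
    when [q] is constant. *)
Lemma zariski_dense_filled_boundary : zariski_dense (filled_boundary r f).
Proof.
move=> q q0; apply: contrapT => nq.
pose p := q * 'X.
have p0 : p != 0 by rewrite mulf_neq0// polyX_eq0.
have sp : (1 < size p)%N by rewrite size_mulX// ltnS size_poly_gt0.
have [y fy py] := zariski_dense_filled p0.
have [z fz mz] := closed_bounded_max (closed_bounded_filled r f)
  (ex_intro _ y fy) (continuous_normc_horner p).
have pz : 0 < normc p.[z] by rewrite (lt_le_trans _ (mz y fy))// normc_gt0.
case: nq; exists z; last first.
  by move: pz; rewrite normc_gt0 /p hornerM mulf_eq0 negb_or => /andP[].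
split=> // e e0; apply: contrapT => ne.
have in_filled w : normc (w - z) < e -> filled r f w.
  by move=> wz; apply: contrapT => nw; apply: ne; exists w.
have [d d0 dp] := horner_open z sp e0.
(* Then (1 + t) p(z) lies within d of p(z) and has larger modulus, so a nearby point attains it. *)
pose t := d / (2 * normc p.[z]).
have t0 : 0 < t by rewrite divr_gt0// mulr_gt0.
have tp : t * normc p.[z] < d.
  have : t * normc p.[z] = d / 2 by rewrite /t; field; rewrite gt_eqF.
  by move=> ->; rewrite ltr_pdivrMr// ltr_pMr// ltr1n.
have [|w wz pw] := dp ((1 + t%:C) * p.[z]).
  by rewrite mulrDl mul1r addrAC subrr add0r normcM normc_real gtr0_norm.
have := mz w (in_filled w wz); rewrite pw normcM.
have -> : 1 + t%:C = (1 + t)%:C by rewrite rmorphD rmorph1.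
rewrite normc_real ger0_norm; last lra.
by rewrite leNgt ltr_pMl// ltrDl t0.
Qed.

End regular.

End filled_set.

(** * The chordal topology and a criterion for normality *)

Section sphere_topology.
Variable R : realType.
Local Notation C := R[i].
Implicit Types (z w : C) (x y : sphere R) (U K : set (sphere R)).

Lemma ball_chordal x (e : R) y : ball x e y <-> chordal x y < e.
Proof. by rewrite ballEmdist. Qed.

Lemma nbhs_chordal x U : nbhs x U <->
  exists2 e : R, 0 < e & forall y, chordal x y < e -> U y.
Proof.
by rewrite nbhs_ballP; split=> -[/= e e0 eU]; exists e.
Qed.

Lemma chordal_le_normc z w : chordal (Some z) (Some w) <= 2 * normc (z - w).
Proof.
have cw1 u : 1 <= chordal_weight u.
  rewrite -ler_sqr ?nnegrE ?ler01 ?(ltW (chordal_weight_gt0 u))//.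
  by rewrite chordal_weight_sqr expr1n lerDl sqr_ge0.
rewrite /= ler_pdivrMr ?mulr_gt0 ?chordal_weight_gt0//.
apply: ler_peMr; first by rewrite mulr_ge0// normc_ge0.
by rewrite mulr_ege1// cw1.
Qed.

Lemma chordal_infty_le w : w != 0 -> chordal None (Some w) <= 2 / normc w.
Proof.
move=> w0; rewrite /= ler_pM2l// lef_pV2 ?posrE ?chordal_weight_gt0 ?normc_gt0//.
exact: normc_le_weight.
Qed.

Lemma chordal_infty_ge w : 2 / (1 + normc w) <= chordal (Some w) None.
Proof.
have n1 : 0 < 1 + normc w by rewrite ltr_pwDl// normc_ge0.
rewrite /= ler_pM2l// lef_pV2 ?posrE ?chordal_weight_gt0//.
have := chordal_weight_lip w 0; rewrite subr0.
by rewrite {2}/chordal_weight normc0 expr0n addr0 sqrtr1.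
Qed.

Definition plane_disc z (r : R) : set (sphere R) :=
  [set x | if x is Some w then normc (w - z) < r else false].

Lemma open_plane_disc z (r : R) : open (plane_disc z r).
Proof.
rewrite openE => -[u|]//= uz; apply/nbhs_chordal.
have [d ed] : exists d, d = r - normc (u - z) by exists (r - normc (u - z)).
have d0 : 0 < d by rewrite ed subr_gt0.
have cu := chordal_weight_gt0 u.
(* With a the weight of [u], a point at Euclidean distance t from [u] has chordal distance at least
   2t / (a (a + t)), which increases with t. So this radius excludes t >= d, and it excludes
   infinity, at distance 2 / a. *)
exists (2 * d / (chordal_weight u * (chordal_weight u + d))).
  by rewrite divr_gt0 ?mulr_gt0 ?addr_gt0.
have cd : 0 < chordal_weight u + d by rewrite addr_gt0.
move=> [w|]; rewrite /chordal; last first.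
  rewrite ltNge => /negP[]; rewrite -mulrA ler_pM2l// invfM mulrCA.
  rewrite ler_piMr ?invr_ge0 ?(ltW cu)// ler_pdivrMr// mul1r lerDr; exact: ltW.
have cw := chordal_weight_gt0 w.
set t := normc (u - w).
move: (chordal_weight u) (chordal_weight w) cu cw cd (chordal_weight_lip w u).
rewrite normcB -/t => a b a0 b0 ad lip h.
have pos : 0 < a * b * (a + d) / 2 by rewrite divr_gt0 ?mulr_gt0.
move: h; rewrite -(ltr_pM2r pos).
have -> : 2 * t / (a * b) * (a * b * (a + d) / 2) = t * (a + d).
  by field; rewrite !gt_eqF.
have -> : 2 * d / (a * (a + d)) * (a * b * (a + d) / 2) = d * b.
  by field; rewrite !gt_eqF.
move=> h.
have td : t < d.
  have : t * (a + d) < d * (a + t) by rewrite (lt_le_trans h)// ler_pM2l.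
  by nra.
rewrite /= (le_lt_trans (ler_dist_normcD _ _ u))// normcB -/t.
by move: td; rewrite ed ltrBrDl addrC.
Qed.

Lemma plane_nbhs z U : nbhs (Some z : sphere R) U ->
  exists2 d : R, 0 < d & forall w, normc (w - z) < d -> U (Some w).
Proof.
move=> /nbhs_chordal [e e0 eU]; exists (e / 2); first by rewrite divr_gt0.
move=> w; rewrite ltr_pdivlMr// mulrC => wz; apply: eU.
by rewrite (le_lt_trans (chordal_le_normc _ _))// normcB.
Qed.

Lemma compact_plane (K : set C) : closed_bounded K ->
  compact [set (Some z : sphere R) | z in K].
Proof.
move=> /closed_bounded_compact cK.
apply: (@continuous_compact (C^o : topologicalType) (sphere R : topologicalType) (@Some C)) => //.
apply: continuous_subspaceT => z U /plane_nbhs [d d0 dU].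
by apply/nbhs_normc; exists d.
Qed.

Lemma uniform_chordal (H : nat -> sphere R -> sphere R) g K :
  {uniform K, H @ \oo --> g} <->
  (forall e : R, 0 < e -> exists N, forall n, (N <= n)%N ->
     forall x, K x -> chordal (g x) (H n x) < e).
Proof.
split=> [Hg e e0|Hg A /uniform_nbhs [E [entE EA]]].
  have := Hg [set h | forall y, K y -> chordal (g y) (h y) < e].
  case=> [|N _ HN]; last by exists N.
  apply/uniform_nbhs; exists [set xy | ball xy.1 e xy.2]; split.
    exact: entourage_ball (PosNum e0).
  by move=> h /= hh y Ky; apply/ball_chordal; exact: hh.
move: entE; rewrite -entourage_ballE => -[/= e e0 eE].
have [N HN] := Hg e e0; exists N => // n Nn; apply: EA => /= y Ky.
by apply: eE => /=; apply/ball_chordal; exact: HN.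
Qed.

Lemma subsequence_ex (P : nat -> nat -> Prop) :
  (forall i N, exists2 k, (N <= k)%N & P i k) ->
  exists phi : nat -> nat, {homo phi : i j / (i < j)%N} /\ forall i, P i (phi i).
Proof.
move=> hP; have /choice [c hc] : forall iN : nat * nat, exists k, (iN.2 <= k)%N /\ P iN.1 k.
  by move=> [i N]; have [k] := hP i N; exists k.
pose phi := fix phi i := if i is i'.+1 then c (i, (phi i').+1) else c (0, 0)%N.
exists phi; split; last by case=> [|i]; exact: (hc (_, _)).2.
by apply: homo_ltn => [y x z|i]; [exact: ltn_trans|exact: (hc (_, _)).1].
Qed.

(** Approximating [g] uniformly on [U] at arbitrarily late indices suffices: pick the i-th index
    with error below 1 / (i + 1). *)
Lemma normal_on_frequently (G : nat -> sphere R -> sphere R) U :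
  (forall s : nat -> nat, (forall k, (0 < s k)%N) -> exists g, forall (e : R) N, 0 < e ->
     exists2 k, (N <= k)%N & forall x, U x -> chordal (g x) (G (s k) x) < e) ->
  normal_on G U.
Proof.
move=> hG s s0; have [g hg] := hG s s0.
have [i N|phi [hphi Pphi]] := @subsequence_ex
    (fun i k => forall x, U x -> chordal (g x) (G (s k) x) < i.+1%:R^-1).
  by apply: hg; rewrite invr_gt0.
exists phi; split=> //; exists g; apply/fam_cvgP => K [_ KU].
apply/uniform_chordal => e e0; exists (Num.bound e^-1) => n Nn x Kx.
apply: lt_trans (Pphi n x (KU x Kx)) _.
rewrite -[ltRHS]invrK ltf_pV2 ?posrE ?invr_gt0//.
apply: lt_le_trans (archi_boundP _) _; first by rewrite invr_ge0 ltW.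
by rewrite ler_nat leqW.
Qed.

End sphere_topology.

(** * Montel's theorem for uniformly bounded polynomials *)

Section montel.
Variable R : realType.
Local Notation C := R[i].
Implicit Types (z w u : C) (p q : {poly C}).

Lemma half_pow_small (x e : R) : 0 < e -> exists n, x / 2 ^+ n < e.
Proof.
move=> e0; exists (Num.bound (x / e)).
rewrite ltr_pdivrMr ?exprn_gt0// mulrC -ltr_pdivrMr//.
exact: upper_nthrootP.
Qed.

(** On the half disc the j-th term is at most B / 2^j, and the geometric series sums to at most
    2. *)
Lemma horner_half_disc p (rho B : R) u : 0 < rho ->
  (forall j, normc p`_j * rho ^+ j <= B) -> normc u <= rho / 2 ->
  normc p.[u] <= 2 * B.
Proof.
move=> rho0 pB u2; apply: le_trans (normc_horner_le p u2) _.
have B0 : 0 <= B by rewrite (le_trans _ (pB 0%N))// mulr_ge0 ?exprn_ge0 ?normc_ge0// ltW.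
apply: (@le_trans _ _ (\sum_(i < size p) B * 2^-1 ^+ i)).
  apply: ler_sum => i _; rewrite exprMn mulrA ler_wpM2r//; exact: pB.
have geo n : \sum_(i < n) (2^-1 : R) ^+ i <= 2 - 2 * 2^-1 ^+ n.
  elim: n => [|n IH]; first by rewrite big_ord0 expr0; lra.
  rewrite big_ord_recr /= (le_trans (lerD IH (lexx _)))// exprS.
  by move: (2^-1 ^+ n) => t; lra.
rewrite -mulr_sumr mulrC ler_wpM2r// (le_trans (geo _))//.
by rewrite lerBlDr lerDl mulr_ge0// exprn_ge0// invr_ge0.
Qed.

(** Limits along one fixed ultrafilter exist for all coefficients and all values at once, which
    replaces a diagonal extraction. *)
Lemma ultra_limit (FF : set_system nat) (a : nat -> C) (M : R) : UltraFilter FF ->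
  (forall k, normc (a k) <= M) ->
  exists l, forall e : R, 0 < e -> FF [set k | normc (a k - l) < e].
Proof.
move=> UF aM.
have /closed_bounded_compact cD := closed_bounded_disc 0 M.
have [] := cD (a k @[k --> FF]) _.
  by apply: (@filterE _ FF) => k; rewrite /= subr0; exact: aM.
move=> l [_ cl]; exists l => e e0.
have [//|far] := in_ultra_setVsetC [set k | normc (a k - l) < e] UF.
have [] := cl [set w | ~ (normc (w - l) < e)] [set w | normc (w - l) < e].
- exact: far.
- by apply/nbhs_normc; exists e.
- by move=> w [].
Qed.

(* By Cauchy's estimates the coefficients stay bounded; along an ultrafilter
   they all converge, and the tails are uniformly small on the half disc. *)
Lemma montel (p : nat -> {poly C}) (rho M : R) : 0 < rho ->
  (forall k u, normc u = rho -> normc (p k).[u] <= M) ->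
  exists g : C -> C, forall (e : R) N, 0 < e -> exists2 k, (N <= k)%N &
    forall u, normc u <= rho / 2 -> normc ((p k).[u] - g u) < e.
Proof.
move=> rho0 pM.
have [UU [UF sU]] := ultraFilterLemma (F := \oo) _.
have cM k j : normc (p k)`_j * rho ^+ j <= M by apply: cauchy_estimate => // u; exact: pM.
have M0 : 0 <= M.
  by rewrite (le_trans _ (cM 0%N 0%N))// mulr_ge0 ?normc_ge0// exprn_ge0// ltW.
have /choice [l hl] : forall j, exists l, forall e : R, 0 < e ->
    UU [set k | normc ((p k)`_j - l) < e].
  move=> j; apply: (@ultra_limit _ _ (M / rho ^+ j)) => // k.
  by rewrite ler_pdivlMr ?exprn_gt0.
have /choice [g hg] : forall u, exists v, normc u <= rho / 2 -> forall e : R, 0 < e ->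
    UU [set k | normc ((p k).[u] - v) < e].
  move=> u; have [u2|] := boolP (normc u <= rho / 2); last by exists 0.
  have [|v hv] := @ultra_limit UU (fun k => (p k).[u]) (2 * M) _; last by exists v.
  by move=> k; exact: horner_half_disc (cM k) u2.
exists g => e N e0.
(* Terms of degree at least n contribute at most 4M / 2^n < e / 2; the low terms give e / 4 and the
   limit e / 16. *)
have [n small] := half_pow_small (4 * M) (divr_gt0 e0 (ltr0n R 2)).
have e10 : 0 < e / 16 by rewrite divr_gt0.
have US : UU [set k | (N <= k)%N /\
    forall j, (j < n)%N -> normc ((p k)`_j - l j) * rho ^+ j < e / 16].
  apply: filterI; first by apply: sU; exists N.
  elim: n {small} => [|n IH]; first by apply: filterE.
  have h := hl n (e / 16 / rho ^+ n) (divr_gt0 e10 (exprn_gt0 _ rho0)).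
  apply: filterS (filterI IH h) => k /= [hk hn] j.
  rewrite ltnS leq_eqVlt => /orP[/eqP ->|]; last exact: hk.
  by rewrite -ltr_pdivlMr// exprn_gt0.
have [k [Nk hk]] := filter_ex US; exists k => // u u2.
(* The index [k] is fixed before [u], while [l'] may depend on [u]: it has low coefficients close to
   those of [p k] and a value at [u] close to [g u]. *)
have [l' [[_ hl'] /= lg]] := filter_ex (filterI US (hg u u2 _ e10)).
pose q := p k - p l'.
have q_low : normc (take_poly n q).[u] <= 2 * (e / 8).
  apply: (@horner_half_disc _ rho) => // j; rewrite coef_take_poly.
  case: ifP => jn; last by rewrite normc0 mul0r divr_ge0// ltW.
  rewrite coefB; have -> : e / 8 = e / 16 + e / 16 by lra.
  have := hk j jn; have := hl' j jn => h1 h2.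
  apply: le_trans (_ : (normc ((p k)`_j - l j) + normc ((p l')`_j - l j)) * rho ^+ j <= _).
    rewrite ler_wpM2r ?exprn_ge0 ?(ltW rho0)//.
    by rewrite (le_trans (ler_dist_normcD _ _ (l j)))// lerD2l normcB.
  by rewrite mulrDl lerD// ltW.
have q_high : normc (drop_poly n q).[u] <= 2 * (2 * M / rho ^+ n).
  apply: (@horner_half_disc _ rho) => // j; rewrite coef_drop_poly coefB.
  rewrite ler_pdivlMr ?exprn_gt0// -mulrA -exprD.
  apply: le_trans (_ : (normc (p k)`_(j + n) + normc (p l')`_(j + n)) * rho ^+ (j + n) <= _).
    by rewrite ler_wpM2r ?exprn_ge0 ?(ltW rho0)// ler_normcB.
  by rewrite mulrDl mulr_natl mulr2n lerD.
have qu : normc q.[u] <= e / 4 + 4 * M / 2 ^+ n.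
  rewrite -[q](poly_take_drop n) hornerD hornerM hornerXn.
  rewrite (le_trans (ler_normcD _ _))// lerD//; first by move: q_low; lra.
  rewrite normcM normcX.
  apply: le_trans (_ : 2 * (2 * M / rho ^+ n) * (rho / 2) ^+ n <= _).
    rewrite ler_pM ?normc_ge0 ?exprn_ge0 ?normc_ge0//.
    by rewrite lerXn2r ?nnegrE ?normc_ge0// divr_ge0// ltW.
  rewrite expr_div_n le_eqVlt; apply/orP; left; apply/eqP.
  by field; rewrite !expf_neq0// gt_eqF.
rewrite (le_lt_trans (ler_dist_normcD _ _ (p l').[u]))//.
have <- : q.[u] = (p k).[u] - (p l').[u] by rewrite hornerD hornerN.
by move: qu lg small; lra.
Qed.

End montel.

(** * The Julia set as the boundary of the filled set *)

Section julia_boundary.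
Variable R : realType.
Local Notation C := R[i].
Implicit Types (z w : C) (f : nat -> {poly C}) (r : R).

Lemma escape_to_infty r f N (e : R) : escape_radius r f -> 0 < e ->
  exists m0, forall m z, (m0 <= m)%N -> r < normc (compose_seq f N).[z] ->
    chordal None (Some (compose_seq f m).[z]) < e.
Proof.
move=> hr e0; have [n ne] := half_pow_small 2 e0.
exists (n + N)%N => m z nm rz; have [r1 _] := hr.
have Nm : (n <= m - N)%N by rewrite leq_subRL ?(leq_trans _ nm) ?leq_addl// addnC.
have := escape_iter (m - N) hr rz.
rewrite subnK ?(leq_trans (leq_addl n N))// => grow.
have big : 2 ^+ n <= normc (compose_seq f m).[z].
  apply: le_trans grow; apply: (@le_trans _ _ (2 ^+ (m - N))).
    by rewrite ler_weXn2l// ler1n.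
  by rewrite ler_peMr ?exprn_ge0// (le_trans r1)// ltW.
have n0 : 0 < normc (compose_seq f m).[z] by rewrite (lt_le_trans _ big)// exprn_gt0.
apply: le_lt_trans (chordal_infty_le _) _; first by rewrite -normc_gt0.
by apply: le_lt_trans ne; rewrite ler_pM2l// lef_pV2 ?posrE ?exprn_gt0.
Qed.

Lemma frequent_value (s : nat -> nat) n N :
  (forall k, (N <= k)%N -> (s k < n)%N) ->
  exists v, forall M, exists2 k, (M <= k)%N & s k = v.
Proof.
move=> sn; apply: contrapT => nv.
have /choice [b hb] : forall v, exists M, forall k, (M <= k)%N -> s k <> v.
  move=> v; apply: contrapT => nM; apply: nv; exists v => M.
  by apply: contrapT => nk; apply: nM; exists M => k Mk skv; apply: nk; exists k.
pose M := maxn N (\max_(v < n) b v).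
have sM : (s M < n)%N by apply: sn; exact: leq_maxl.
apply: (hb (s M) M) => //.
apply: leq_trans (leq_maxr N _).
exact: (leq_bigmax (F := fun v : 'I_n => b v) (Ordinal sM)).
Qed.

(** Some |F_N| exceeds r on a whole disc about z. Along unbounded indices the iterates then tend to
    infinity uniformly there; otherwise one index recurs infinitely often and gives a constant
    subsequence. *)
Lemma escaping_fatou r f z : escape_radius r f -> ~ filled r f z -> Defs.fatou f (Some z).
Proof.
move=> hr nz; have [N rz] : exists N, r < normc (compose_seq f N).[z].
  apply: contrapT => nN; apply: nz => n; rewrite leNgt; apply/negP => rn.
  by apply: nN; exists n.
have rz' : 0 < normc (compose_seq f N).[z] - r by rewrite subr_gt0.
have [d d0 dF] := continuous_normc_horner (compose_seq f N) z rz'.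
exists (plane_disc z d); split; first exact: open_plane_disc.
  by rewrite /= subrr normc0.
apply: normal_on_frequently => s s0.
have [unb|bnd] := pselect (forall n M, exists2 k, (M <= k)%N & (n <= s k)%N).
  exists (fun=> None) => e M e0.
  have [m0 hm0] := escape_to_infty N hr e0.
  have [k Mk m0k] := unb m0 M; exists k => // -[w|//] /= wz.
  apply: (hm0 (s k) w m0k).
  by have := dF w wz; rewrite distrC => /(le_lt_trans (ler_norm _)); lra.
have [v hv] : exists v, forall M, exists2 k, (M <= k)%N & s k = v.
  apply: contrapT => nv; apply: bnd => n M; apply: contrapT => nk; apply: nv.
  apply: (@frequent_value s n M) => k Mk; rewrite ltnNge; apply/negP => nsk.
  by apply: nk; exists k.
exists (sphere_map (compose_seq f v)) => e M e0; have [k Mk sk] := hv M.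
by exists k => // x _; rewrite sk chordalxx.
Qed.

(** All iterates are bounded by [r] on the disc, so Montel applies after recentring at [z]; the
    circle of radius d / 2 controls the disc of radius d / 4. *)
Lemma interior_filled_fatou r f z (d : R) : 0 < d ->
  (forall w, normc (w - z) < d -> filled r f w) -> Defs.fatou f (Some z).
Proof.
move=> d0 fd; exists (plane_disc z (d / 4)); split; first exact: open_plane_disc.
  by rewrite /= subrr normc0 divr_gt0.
apply: normal_on_frequently => s s0.
pose p k := compose_seq f (s k) \Po ('X + z%:P).
have pE k u : (p k).[u] = (compose_seq f (s k)).[u + z].
  by rewrite horner_comp !hornerE.
have [k u ud|g hg] := @montel R p (d / 2) r (divr_gt0 d0 (ltr0n R 2)).
  rewrite pE; apply: fd; rewrite addrK ud ltr_pdivrMr// ltr_pMr// ltr1n//.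
exists (fun x => if x is Some w then Some (g (w - z)) else None) => e N e0.
have [k Nk hk] := hg (e / 2) N (divr_gt0 e0 (ltr0n R 2)).
exists k => // -[w|//] /= wz.
apply: le_lt_trans (chordal_le_normc _ _) _.
have := hk (w - z); rewrite pE subrK => h.
rewrite mulrC -ltr_pdivlMr// normcB; apply: h.
by rewrite (le_trans (ltW wz))// -mulrA -invfM -natrM.
Qed.

(** A locally uniform limit g cannot exist. Take w near z outside the filled set: both F(w), close
    to F(z), and a late iterate of w, close to infinity, are close to g(w), whereas F(z) stays away
    from infinity. *)
Lemma filled_boundary_julia r f z : escape_radius r f ->
  filled_boundary r f z -> julia f (Some z).
Proof.
move=> hr [fz nz] [U [oU Uz normU]].
have [r1 _] := hr.
have [d d0 dU] : exists2 d : R, 0 < d & forall w, normc (w - z) < d -> U (Some w).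
  by apply: plane_nbhs; exact: open_nbhs_nbhs.
pose D := [set w : C | normc (w - z) <= d / 2].
have [phi [hphi [g /fam_cvgP hg]]] := normU succn (fun k => ltn0Sn k).
have cD : compact [set (Some w : sphere R) | w in D].
  by apply: compact_plane; exact: closed_bounded_disc.
have KU : [set (Some w : sphere R) | w in D] `<=` U.
  move=> _ [w Dw <-]; apply: dU; rewrite (le_lt_trans Dw)//.
  by rewrite ltr_pdivrMr// ltr_pMr// ltr1n.
have r0 : 0 < 1 + r by rewrite ltr_pwDl// (le_trans ler01).
(* A quarter of 2 / (1 + r), which bounds from below the chordal distance from the orbit of [z] to
   infinity; four errors below [e] will be chained. *)
pose e := 1 / (2 * (1 + r)); have e0 : 0 < e by rewrite divr_gt0// mulr_gt0.
have [N hN'] := (uniform_chordal _ _ _).1 (hg _ (conj cD KU)) e e0.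
have hN n w : (N <= n)%N -> D w ->
    chordal (g (Some w)) (Some (compose_seq f (phi n).+1).[w]) < e.
  by move=> Nn Dw; apply: (hN' n Nn (Some w)); exists w.
have e20 : 0 < e / 2 by rewrite divr_gt0.
set F := compose_seq f (phi N).+1.
have [d' d'0 dF] := horner_continuous F z e20.
have min0 : 0 < Num.min (d / 2) d' by rewrite lt_min divr_gt0.
have [w] := nz _ min0; rewrite lt_min => /andP[wd wd'] nfw.
have Dw : D w by exact: ltW.
have [m rm] : exists m, r < normc (compose_seq f m).[w].
  apply: contrapT => nm; apply: nfw => n; rewrite leNgt; apply/negP => rn.
  by apply: nm; exists n.
have [m0 hm0] := escape_to_infty m hr e0.
have phi_ge n : (n <= phi n)%N.
  by elim: n => // n IH; exact: leq_ltn_trans IH (hphi _ _ (ltnSn n)).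
pose n := maxn N m0.
have h1 : chordal None (Some (compose_seq f (phi n).+1).[w]) < e.
  by apply: hm0 rm; rewrite leqW// (leq_trans (leq_maxr N m0)).
have h2 := hN n w (leq_maxl _ _) Dw; have h3 := hN N w (leqnn N) Dw.
have h4 : chordal (Some F.[w]) (Some F.[z]) < e.
  apply: le_lt_trans (chordal_le_normc _ _) _.
  by rewrite mulrC -ltr_pdivlMr// dF.
have h5 : 4 * e <= chordal (Some F.[z]) None.
  apply: le_trans (chordal_infty_ge _); have := fz (phi N).+1; rewrite -/F => Fz.
  have -> : 4 * e = 2 / (1 + r) by rewrite /e; field; rewrite gt_eqF.
  by rewrite ler_pM2l// lef_pV2 ?posrE ?lerD2l// ltr_pwDl// normc_ge0.
move: h5; apply/negP; rewrite -ltNge chordal_sym.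
set x := g (Some w) in h2 h3; set y := Some (compose_seq f (phi n).+1).[w] in h1 h2.
have t1 := chordal_triangle y (None : sphere R) (Some F.[z]).
have t2 := chordal_triangle x y (Some F.[z]).
have t3 := chordal_triangle (Some F.[w]) x (Some F.[z]).
rewrite (chordal_sym y x) in t2.
move: h1 h2 h3 h4 t1 t2 t3; rewrite -/F => h1 h2 h3 h4 t1 t2 t3.
by lra.
Qed.

Lemma julia_filled_boundary r f z : escape_radius r f ->
  julia f (Some z) <-> filled_boundary r f z.
Proof.
move=> hr; split; last exact: filled_boundary_julia.
move=> Jz; have [fz|/(escaping_fatou hr)//] := pselect (filled r f z).
split=> // e e0; apply: contrapT => nw; apply: Jz.
apply: (interior_filled_fatou (r := r) e0) => w wz.
by apply: contrapT => nfw; apply: nw; exists w.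
Qed.

End julia_boundary.

(** * Symmetry for even polynomials *)

Section even.
Variable R : realType.
Local Notation C := R[i].
Implicit Types (z : C) (p : {poly C}) (K : set C).

Lemma horner_even p z : (forall j, odd j -> p`_j = 0) -> p.[- z] = p.[z].
Proof.
move=> p_even; rewrite !horner_coef; apply: eq_bigr => j _.
have [oj|ej] := boolP (odd j); first by rewrite p_even// !mul0r.
by rewrite exprNn -signr_odd (negPf ej) expr0 mul1r.
Qed.

(** The set is the preimage under the even polynomial F_1 of the boundary for the sequence shifted
    by one. *)
Lemma filled_boundary_sym r (f : nat -> {poly C}) z :
  escape_radius r f -> regular_poly_seq f ->
  (forall n j, (0 < n)%N -> odd j -> (f n)`_j = 0) ->
  filled_boundary r f z -> filled_boundary r f (- z).
Proof.
move=> hr reg f_even.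
have sh y := @filled_boundary_shift R r f 1 y hr (size_compose_seq reg 1).
move=> /sh Jz; apply/sh; move: Jz; rewrite /= !horner_comp !hornerX.
by rewrite horner_even// => j; exact: f_even.
Qed.

Lemma supnorm_center_opp K c : (forall z, K z -> K (- z)) ->
  supnorm K ('X - (- c)%:P) = supnorm K ('X - c%:P).
Proof.
move=> symK.
have opp z : ('X - c%:P).[- z] = - ('X - (- c)%:P).[z] by rewrite !hornerE; ring.
congr sup; apply/seteqP; split=> x [z Kz <-]; exists (- z); try exact: symK.
  by rewrite opp normcN.
by rewrite -[in RHS](opprK z) opp normcN.
Qed.

End even.

(** * Chebyshev polynomials on the Julia set *)

Theorem theorem3p2 (R : realType) (f : nat -> {poly R[i]})
    (f_regular : regular_poly_seq f) :
  let F := compose_seq f in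
  let J : set R[i] := [set z | julia f (Some z)] in
  (forall m : nat, (0 < m)%N -> exists tau : R[i],
     is_chebyshev J (size (F m)).-1 ((lead_coef (F m))^-1 *: F m - tau%:P))
  /\
  ((forall n j : nat, (0 < n)%N -> odd j -> (f n)`_j = 0) ->
   forall m : nat, (0 < m)%N ->
     is_chebyshev J (size (F m)).-1 ((lead_coef (F m))^-1 *: F m)).
Proof.
move=> F J.
have [r hr] := regular_escape f_regular.
pose K m := filled_boundary r (shift_seq m f).
have JE m : J = [set z | K m (F m).[z]].
  apply/seteqP; split=> z /=.
    move=> /(julia_filled_boundary z hr).
    by move=> /(filled_boundary_shift z hr (size_compose_seq f_regular m)).
  move=> /(filled_boundary_shift z hr (size_compose_seq f_regular m)).
  by move=> /(julia_filled_boundary z hr).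
have cK m : closed_bounded (K m) by exact: closed_bounded_filled_boundary.
have K0 m : K m !=set0.
  apply: zariski_dense_nonempty; apply: zariski_dense_filled_boundary.
    exact: regular_shift.
  exact: escape_shift.
have JB : J = filled_boundary r f.
  by apply/seteqP; split=> z /(julia_filled_boundary z hr).
have cheb m c :
    (forall c', supnorm (K m) ('X - c%:P) <= supnorm (K m) ('X - c'%:P)) ->
    is_chebyshev J (size (F m)).-1
      ((lead_coef (F m))^-1 *: F m - ((lead_coef (F m))^-1 * c)%:P).
  rewrite (JE m) => minc; apply: chebyshev_preimage => //.
  - exact: size_compose_seq.
  - by rewrite -JE JB; exact: closed_bounded_filled_boundary.
  - by rewrite -JE JB; exact: zariski_dense_filled_boundary.
split=> [m _|f_even m _]; have [c minc] := chebyshev_center (cK m) (K0 m).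
  by exists ((lead_coef (F m))^-1 * c); exact: cheb.
have symK z : K m z -> K m (- z).
  apply: filled_boundary_sym; [exact: escape_shift|exact: regular_shift|].
  by move=> n j n0; apply: f_even; rewrite addn_gt0 n0.
(* By symmetry of [K m], -c is an optimal centre as well; uniqueness of the Chebyshev polynomial on
   [J] then gives c = -c. *)
have minNc c' : supnorm (K m) ('X - (- c)%:P) <= supnorm (K m) ('X - c'%:P).
  by rewrite supnorm_center_opp.
have chebc := cheb m c minc.
have [_ _ [_ uniq_c]] := chebc; have [_ _ [min_Nc _]] := cheb m (- c) minNc.
have := uniq_c _ min_Nc => /addrI /oppr_inj /polyC_inj /mulfI.
have l0 : lead_coef (F m) != 0.
  by rewrite lead_coef_eq0 -size_poly_gt0 ltnW// size_compose_seq.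
move=> /(_ (invr_neq0 l0)) cN.
have c0 : c = 0.
  by have /eqP := subrr c; rewrite {2}cN opprK -mulr2n mulrn_eq0 => /eqP.
by move: chebc; rewrite c0 mulr0 subr0.
Qed.
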